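(* There exist absolute constants $c$ and $c_1$ for which the following holds. Let $\mu$ be an isotropic, log-concave probability measure on $\mathbb{R}^n$, let $X_1,\dots,X_N$ be independent, distributed according to $\mu$, and let $\Gamma=\sum_{i=1}^N\langle X_i,\cdot\rangle e_i:\ell_2^n\to\ell_2^N$. Then for every convex body $K \subset \mathbb{R}^n$, $$ \mathbb{E} \left(\mathrm{diam}(K \cap \ker \Gamma) \right) \leq c_1 \inf\left\{ r >0 : \gamma_2(K \cap r S^{n-1},\psi_2)/\sqrt{N} \leq cr \right\}. $$
   Context: A symmetric probability measure $\mu$ on $\mathbb{R}^n$ is isotropic if $\int\langle x,y\rangle^2d\mu(x)=\|y\|_2^2$ for every $y$; log-concave if $\mu(\lambda A+(1-\lambda)B)\ge\mu(A)^\lambda\mu(B)^{1-\lambda}$ for all $0<\lambda<1$ and nonempty Borel $A,B$. A convex body is a compact, convex, symmetric set with nonempty interior. Diameters are Euclidean; $S^{n-1}$ is the Euclidean unit sphere. $\|f\|_{\psi_2}=\inf\{C>0:\mathbb{E}\exp(f^2/C^2)\le2\}$ w.r.t. $\mu$. For $T\subset\mathbb{R}^n$, $\gamma_2(T,\psi_2)$ is $\gamma_2$ of $\{\langle x,\cdot\rangle:x\in T\}$ with metric $\|\langle x-y,\cdot\rangle\|_{\psi_2}$, where $\gamma_2(T,d)=\inf\sup_{t\in T}\sum_{s\ge0}2^{s/2}d(t,T_s)$, infimum over families $T_s\subset T$ with $|T_0|=1$, $|T_s|\le2^{2^s}$. *)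

(* Defs.v *)
From HB Require Import structures.
From mathcomp Require Import all_boot all_order all_algebra.
From mathcomp Require Import all_classical all_reals all_analysis.
Set Implicit Arguments. Unset Strict Implicit. Unset Printing Implicit Defensive.
Import Order.TTheory GRing.Theory Num.Theory.
Import numFieldNormedType.Exports.
Local Open Scope classical_set_scope.
Local Open Scope ring_scope.

(* R^n with its Borel sigma-algebra (generated by the open sets of the
   (product = Euclidean) topology on row vectors). *)
Definition Rn (R : realType) (n : nat) :=
  g_sigma_algebraType (@open 'rV[R]_n).

Definition dot (R : realType) (n : nat) (x y : 'rV[R]_n) : R :=
  \sum_(i < n) x ord0 i * y ord0 i.

Definition norm2 (R : realType) (n : nat) (x : 'rV[R]_n) : R :=
  Num.sqrt (dot x x).

Definition sphere (R : realType) (n : nat) (r : R) : set 'rV[R]_n :=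
  [set x | norm2 x = r].

Definition diam (R : realType) (n : nat) (S : set 'rV[R]_n) : \bar R :=
  ereal_sup [set e | exists2 x, S x & exists2 y, S y & e = (norm2 (x - y))%:E].

Definition convex_body (R : realType) (n : nat) (K : set 'rV[R]_n) : Prop :=
  [/\ compact K,
      (forall x y (t : R), K x -> K y -> 0 <= t -> t <= 1 ->
          K (t *: x + (1 - t) *: y)),
      (forall x, K x -> K (- x)) &
      (interior K) !=set0 ].

Section measure_defs.
Local Open Scope ereal_scope.

Definition symmetric_measure (R : realType) (n : nat)
  (mu : probability (Rn R n) R) : Prop :=
  forall A : set (Rn R n), measurable A ->
    mu [set (- x)%R | x in A] = mu A.

Definition isotropic (R : realType) (n : nat)
  (mu : probability (Rn R n) R) : Prop :=
  forall y : 'rV[R]_n,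
    \int[mu]_x ((dot x y) ^+ 2)%R%:E = ((norm2 y) ^+ 2)%R%:E.

(* mu(l A + (1-l) B) >= mu(A)^l mu(B)^(1-l); since l A + (1-l) B need not be
   Borel, this is required for every Borel C containing l A + (1-l) B. *)
Definition log_concave (R : realType) (n : nat)
  (mu : probability (Rn R n) R) : Prop :=
  forall (l : R) (A B C : set (Rn R n)),
    (0 < l)%R -> (l < 1)%R ->
    measurable A -> measurable B -> A !=set0 -> B !=set0 ->
    measurable C ->
    (forall a b, A a -> B b -> C (l *: a + (1 - l) *: b)%R) ->
    (((fine (mu A)) `^ l) * ((fine (mu B)) `^ (1 - l)))%R%:E <= mu C.

Definition psi2 (R : realType) (n : nat) (mu : probability (Rn R n) R)
  (f : Rn R n -> R) : \bar R :=
  ereal_inf [set C%:E | C in [set C : R | (0 < C)%R /\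
     \int[mu]_x (expR (f x ^+ 2 / C ^+ 2))%R%:E <= 2%:E]].

Definition psi2dist (R : realType) (n : nat) (mu : probability (Rn R n) R)
  (x y : 'rV[R]_n) : \bar R :=
  psi2 mu (fun z : Rn R n => dot (x - y)%R z).

Definition setdist (R : realType) (V : Type) (d : V -> V -> \bar R)
  (t : V) (S : set V) : \bar R :=
  ereal_inf [set d t u | u in S].

Definition admissible (V : Type) (T : set V) (A : nat -> set V) : Prop :=
  (forall s, A s `<=` T) /\
  (exists t0 : V, A 0%N `<=` [set t0]) /\
  (forall s, exists f : 'I_(2 ^ (2 ^ s)) -> V, A s `<=` range f).

Definition gamma2 (R : realType) (V : Type) (T : set V)
  (d : V -> V -> \bar R) : \bar R :=
  ereal_inf [set ereal_sup [set \sum_(0 <= s <oo)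
                 ((Num.sqrt 2) ^+ s)%R%:E * setdist d t (A s) | t in T]
            | A in admissible T].

End measure_defs.

Definition kerG (R : realType) (n N : nat) (T : Type)
  (X : 'I_N -> T -> Rn R n) (w : T) : set 'rV[R]_n :=
  [set x | forall i, dot (X i w) x = 0].

Definition iid_law (R : realType) (n N : nat) (d : measure_display)
  (T : measurableType d) (P : probability T R)
  (mu : probability (Rn R n) R) (X : 'I_N -> T -> Rn R n) : Prop :=
  [/\ (forall i, measurable_fun setT (X i)),
      (forall i (A : set (Rn R n)), measurable A -> P (X i @^-1` A) = mu A) &
      (forall A : 'I_N -> set (Rn R n), (forall i, measurable (A i)) ->
         P (\bigcap_(i in [set: 'I_N]) (X i @^-1` A i)) =
         (\prod_(i < N) P (X i @^-1` A i))%E)].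

(* Main.v *)
Require Import Defs.
From HB Require Import structures.
From mathcomp Require Import all_boot all_order all_algebra.
From mathcomp Require Import all_classical all_reals all_analysis.
From mathcomp Require Import measurable_realfun.
From mathcomp Require Import ring lra zify.
Set Implicit Arguments. Unset Strict Implicit. Unset Printing Implicit Defensive.
Import Order.TTheory GRing.Theory Num.Theory.
Import numFieldNormedType.Exports.
Local Open Scope classical_set_scope.
Local Open Scope ring_scope.

(** Let T be the part of K on the sphere of radius r, and suppose that
    gamma_2(T, psi_2) <= c r sqrt N.  As psi_2 dominates the Euclidean norm, if T
    is nonempty then N is large, the admissible sequence has a level with at most
    2^(N/64) points approximating T to within r/32, and chaining beyond that
    level bounds Gamma on the remainders by v r sqrt N / 80 outside an event of
    probability exp(- c v^2 N).

    Since the expectation of the diameter is wanted, the probability that the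
    kernel contains a vector of K of norm rho >> r has to decay with rho/r.
    Convexity and symmetry of K turn the one-scale approximation of T into nets of
    K at all scales: passing from radius rho to radius r costs (rho/r)^(N/64)
    points.  On the other hand, log-concavity of u |-> mu{<x,y> >= u} gives
    mu{|<x,y>| <= t |y|} <= C t for every t, hence by independence
    P(|Gamma z| <= t^2 sqrt N |z|) <= (C t)^N.  A kernel vector of norm rho forces
    |Gamma z| <= 4 v r sqrt N at a net point z with |z| >= rho/2, and the union
    bound beats the cardinality of the net.  Choosing v ~ sqrt (rho/r) makes all
    failure probabilities at most (r/rho)^2, and the sum over rho = 16^(k+1) r
    converges to a constant multiple of r. *)

(** * Euclidean geometry and the sampling operator *)

Section euclidean.
Context {R : realType} {n : nat}.
Implicit Types (x y z : 'rV[R]_n) (a : R).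

Lemma dotC x y : dot x y = dot y x.
Proof. by apply: eq_bigr => i _; rewrite mulrC. Qed.

Lemma dotDl x y z : dot (x + y) z = dot x z + dot y z.
Proof. by rewrite /dot -big_split; apply: eq_bigr => i _; rewrite !mxE mulrDl. Qed.

Lemma dotZl a x z : dot (a *: x) z = a * dot x z.
Proof. by rewrite /dot mulr_sumr; apply: eq_bigr => i _; rewrite !mxE mulrA. Qed.

Lemma dotDr x y z : dot z (x + y) = dot z x + dot z y.
Proof. by rewrite dotC dotDl !(dotC z). Qed.

Lemma dotZr a x z : dot z (a *: x) = a * dot z x.
Proof. by rewrite dotC dotZl (dotC z). Qed.

Lemma dotNl x y : dot (- x) y = - dot x y.
Proof. by rewrite -scaleN1r dotZl mulN1r. Qed.

Lemma dotNr x y : dot x (- y) = - dot x y.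
Proof. by rewrite dotC dotNl dotC. Qed.

Lemma dot_ge0 x : 0 <= dot x x.
Proof. by apply: sumr_ge0 => i _; rewrite -expr2 sqr_ge0. Qed.

Lemma norm2_ge0 x : 0 <= norm2 x.
Proof. exact: sqrtr_ge0. Qed.

Lemma sqr_norm2 x : norm2 x ^+ 2 = dot x x.
Proof. by rewrite sqr_sqrtr// dot_ge0. Qed.

Lemma norm2Z a x : norm2 (a *: x) = `|a| * norm2 x.
Proof.
by rewrite /norm2 dotZl dotZr mulrA -expr2 sqrtrM ?sqr_ge0// sqrtr_sqr.
Qed.

Lemma norm2N x : norm2 (- x) = norm2 x.
Proof. by rewrite -scaleN1r norm2Z normrN normr1 mul1r. Qed.

Lemma norm2_0 : norm2 (0 : 'rV[R]_n) = 0.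
Proof. by rewrite -(scale0r 0) norm2Z normr0 mul0r. Qed.

Lemma norm2_eq0 x : norm2 x = 0 -> x = 0.
Proof.
move=> h; have : dot x x == 0 by rewrite -sqr_norm2 h expr0n.
rewrite /dot psumr_eq0; last by move=> i _; rewrite -expr2 sqr_ge0.
move=> /allP h0; apply/rowP => i; rewrite mxE.
by have := h0 i; rewrite mem_index_enum => /(_ isT); rewrite /= mulf_eq0 orbb => /eqP.
Qed.

Lemma norm2_gt0 x : x != 0 -> 0 < norm2 x.
Proof.
by move=> x0; rewrite lt_def norm2_ge0 andbT; apply: contra x0 => /eqP/norm2_eq0->.
Qed.

Lemma cauchy_schwarz x y : dot x y <= norm2 x * norm2 y.
Proof.
have [->|x0] := eqVneq x 0; first by rewrite norm2_0 mul0r -(scale0r 0) dotZl mul0r.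
have [->|y0] := eqVneq y 0; first by rewrite norm2_0 mulr0 -(scale0r 0) dotZr mul0r.
(* This square expands to [2 * a * b * (a * b - d)]. *)
have := dot_ge0 (norm2 y *: x - norm2 x *: y).
rewrite !(dotDl, dotDr, dotNl, dotNr, dotZl, dotZr) -!sqr_norm2 (dotC y x).
have p := norm2_gt0 x0; have q := norm2_gt0 y0.
set a := norm2 x; set b := norm2 y; set d := dot x y => h.
have : 0 <= (2 * a * b) * (a * b - d) by rewrite -/a -/b in p q; nra.
by rewrite pmulr_rge0 ?subr_ge0// !mulr_gt0.
Qed.

Lemma norm2D x y : norm2 (x + y) <= norm2 x + norm2 y.
Proof.
rewrite -(ler_pXn2r (n := 2))// ?nnegrE ?addr_ge0 ?norm2_ge0//.
rewrite sqr_norm2 !(dotDl, dotDr) -!sqr_norm2 (dotC y x).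
by have := cauchy_schwarz x y; nra.
Qed.

Lemma norm2B x y : norm2 (x - y) <= norm2 x + norm2 y.
Proof. by rewrite (le_trans (norm2D _ _))// norm2N. Qed.

Lemma norm2_le_dist x y : norm2 x <= norm2 y + norm2 (x - y).
Proof. by rewrite -{1}(subrKC y x) norm2D. Qed.

Lemma norm2_le_coord a x : 0 <= a -> (forall i, `|x ord0 i| <= a) ->
  norm2 x <= Num.sqrt n%:R * a.
Proof.
move=> a0 h; rewrite -(ger0_norm a0) -sqrtr_sqr -sqrtrM// ler_wsqrtr//.
rewrite /dot (le_trans (y := \sum_(i < n) a ^+ 2))//.
  by apply: ler_sum => i _; rewrite -expr2 -real_normK ?num_real// lerXn2r ?nnegrE.
by rewrite sumr_const card_ord mulr_natl.
Qed.

End euclidean.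

(* The paper's operator Gamma at the sample v. *)
Definition sampling {R : realType} {n N : nat} (v : 'I_N -> 'rV[R]_n)
    (z : 'rV[R]_n) : 'rV[R]_N := \row_i dot (v i) z.

Section sampling.
Context {R : realType} {n N : nat} (v : 'I_N -> 'rV[R]_n).

Lemma samplingD x y : sampling v (x + y) = sampling v x + sampling v y.
Proof. by apply/rowP => i; rewrite !mxE dotDr. Qed.

Lemma samplingZ a x : sampling v (a *: x) = a *: sampling v x.
Proof. by apply/rowP => i; rewrite !mxE dotZr. Qed.

Lemma sampling0 : sampling v 0 = 0.
Proof. by rewrite -(scale0r (0 : 'rV[R]_n)) samplingZ !scale0r. Qed.

Lemma samplingN x : sampling v (- x) = - sampling v x.
Proof. by rewrite -scaleN1r samplingZ scaleN1r. Qed.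

Lemma samplingB x y : sampling v (x - y) = sampling v x - sampling v y.
Proof. by rewrite samplingD samplingN. Qed.

(** A crude operator norm bound depending on the sample. It serves only to make the far end of a
    chain negligible, so its size does not matter. *)
Lemma sampling_bounded : exists2 L : R, 0 <= L &
  forall z, norm2 (sampling v z) <= L * norm2 z.
Proof.
exists (Num.sqrt N%:R * \sum_i norm2 (v i)) => [|z].
  by rewrite mulr_ge0// sumr_ge0// => i _; exact: norm2_ge0.
rewrite -mulrA norm2_le_coord//.
  by rewrite mulr_ge0 ?norm2_ge0// sumr_ge0// => i _; exact: norm2_ge0.
move=> i; rewrite mxE (le_trans (y := norm2 (v i) * norm2 z))//.
  rewrite ler_norml cauchy_schwarz andbT lerNl -dotNl.
  by rewrite (le_trans (cauchy_schwarz _ _))// norm2N.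
rewrite ler_wpM2r ?norm2_ge0// (bigD1 i)//= lerDl sumr_ge0// => j _.
exact: norm2_ge0.
Qed.

Lemma sqr_norm2_sampling z : norm2 (sampling v z) ^+ 2 = \sum_i dot (v i) z ^+ 2.
Proof. by rewrite sqr_norm2; apply: eq_bigr => i _; rewrite mxE expr2. Qed.

End sampling.

(** * Independence and outer probability *)

Section independence.
Context {R : realType}.

Lemma measurable_dot n (y : 'rV[R]_n) :
  measurable_fun setT (fun x : Rn R n => dot x y).
Proof.
have mc i : measurable_fun setT (fun x : Rn R n => (x : 'rV[R]_n) ord0 i).
  apply: (measurability _ (RGenOpens.measurableE R)).
  move=> _ [_ [a [b ->]] <-]; rewrite setTI.
  apply: sub_sigma_algebra.
  have /continuousP := @coord_continuous R 1 n ord0 i.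
  by apply; exact: interval_open.
by apply: measurable_sum => i; exact: measurable_funM.
Qed.

Import HBNNSimple.
Local Open Scope ereal_scope.

(** Independence is given on events only. This passes from indicators of [X] to functions of [X] in
    the presence of a weight [G], through simple functions and monotone limits. *)
Lemma ge0_integral_factor d d' (T : measurableType d) (U : measurableType d')
    (P : {measure set T -> \bar R}) (mu : {measure set U -> \bar R})
    (X : T -> U) (G : T -> R) (c : R) :
  measurable_fun setT X -> measurable_fun setT G -> (forall w, (0 <= G w)%R) ->
  (0 <= c)%R ->
  (forall A, measurable A -> \int[P]_w (G w * \1_A (X w))%:E = c%:E * mu A) ->
  forall F : U -> R, measurable_fun setT F -> (forall x, (0 <= F x)%R) ->
  \int[P]_w (G w * F (X w))%:E = c%:E * \int[mu]_x (F x)%:E.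
Proof.
move=> mX mG G0 c0 GA F mF F0.
have sfun (h : {nnsfun U >-> R}) :
    \int[P]_w (G w * h (X w))%:E = c%:E * \int[mu]_x (h x)%:E.
  have mh r : measurable (h @^-1` [set r]) by exact: measurable_sfunP.
  have mi r : measurable_fun setT
      (fun w => G w * (\1_(h @^-1` [set r]) (X w) : R))%R.
    apply: measurable_funM => //; apply: measurableT_comp mX.
    exact: measurable_indic.
  rewrite integralT_nnsfun sintegralE ge0_mule_fsumr; last first.
    by move=> r; exact: nnsfun_mulemu_ge0.
  transitivity (\int[P]_w \sum_(r \in range h)
      (r * (G w * \1_(h @^-1` [set r]) (X w)))%:E).
    apply: eq_integral => w _.
    transitivity ((G w)%:E * \sum_(r \in range h)
        (r * \1_(h @^-1` [set r]) (X w))%:E).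
      by rewrite fsumEFin// -fimfunE EFinM.
    rewrite ge0_mule_fsumr; last by move=> r; exact: nnfun_muleindic_ge0.
    by apply: eq_fsbigr => r _; rewrite -EFinM; congr (_%:E); ring.
  have hpos r : range h r -> (0 <= r)%R by move=> [x _ <-].
  (* Exchanging sum and integral asks for nonnegative terms at every real [r], not only at values of
     [h]; hence the truncation. *)
  transitivity (\int[P]_w \sum_(r \in range h)
      (Num.max r 0 * (G w * \1_(h @^-1` [set r]) (X w)))%:E).
    apply: eq_integral => w _; apply: eq_fsbigr => r /set_mem/hpos r0.
    by rewrite (max_idPl r0).
  rewrite ge0_integral_fsum//=; last 2 first.
  - by move=> r; apply/measurable_EFinP; exact: measurable_funM.
  - by move=> r w _; rewrite lee_fin mulr_ge0 ?mulr_ge0// le_max lexx orbT.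
  apply: eq_fsbigr => r /set_mem/hpos r0; rewrite (max_idPl r0).
  under eq_integral do rewrite EFinM.
  rewrite ge0_integralZl_EFin//=; last 2 first.
  - by move=> w _; rewrite lee_fin mulr_ge0.
  - exact/measurable_EFinP/mi.
  by rewrite GA// muleCA.
have mFE : measurable_fun setT (EFin \o F) by exact/measurable_EFinP.
pose f_ := nnsfun_approx measurableT mFE.
have F0' : forall x, setT x -> 0 <= (EFin \o F) x by move=> x _; rewrite lee_fin.
have FE : \int[mu]_x (F x)%:E = limn (fun k => \int[mu]_x (f_ k x)%:E).
  rewrite -monotone_convergence//.
  - by apply: eq_integral => x _; apply/esym/cvg_lim => //; exact: cvg_nnsfun_approx.
  - by move=> k; exact/measurable_EFinP.
  - by move=> k x _; rewrite lee_fin.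
  - by move=> x _ a b ab; rewrite lee_fin; exact/lefP/nd_nnsfun_approx.
have GE : \int[P]_w (G w * F (X w))%:E =
    limn (fun k => \int[P]_w (G w * f_ k (X w))%:E).
  rewrite -monotone_convergence//.
  - apply: eq_integral => w _; apply/esym/cvg_lim => //.
    under eq_fun do rewrite EFinM.
    by rewrite EFinM; apply: cvgeZl => //; exact: cvg_nnsfun_approx.
  - move=> k; apply/measurable_EFinP; apply: measurable_funM => //.
    exact: measurableT_comp mX.
  - by move=> k w _; rewrite lee_fin mulr_ge0.
  - move=> w _ a b ab; rewrite lee_fin ler_wpM2l//.
    exact/lefP/nd_nnsfun_approx.
rewrite GE FE; under eq_fun do rewrite sfun.
have cvgf : cvgn (fun k => \int[mu]_x (f_ k x)%:E).
  apply: ereal_nondecreasing_is_cvgn => a b ab; apply: ge0_le_integral => //.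
  - by move=> x _; rewrite lee_fin.
  - exact/measurable_EFinP.
  - exact/measurable_EFinP.
  - by move=> x _; rewrite lee_fin; exact/lefP/nd_nnsfun_approx.
by rewrite limeMl.
Qed.
End independence.

Section iid.
Context {R : realType} {n N : nat} {d : measure_display} {T : measurableType d}.
Context (P : probability T R) (mu : probability (Rn R n) R).
Context (X : 'I_N -> T -> Rn R n) (iid : iid_law P mu X).

(** Indicators are replaced by [F] one coordinate at a time: [k = 0] is independence of events and
    [k = N] is the product formula. The sets [A] vary in the induction because the step tests the
    new coordinate on an arbitrary event. *)
Local Lemma integral_prod_iid_rec (F : Rn R n -> R) (q : R) :
  measurable_fun setT F -> (forall x, 0 <= F x) -> (\int[mu]_x (F x)%:E = q%:E)%E ->
  forall k (A : 'I_N -> set (Rn R n)), (forall i, measurable (A i)) ->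
  (\int[P]_w (\prod_(i < N) (if (i < k)%N then F (X i w) else \1_(A i) (X i w)))%:E =
   (\prod_(i < N) (if (i < k)%N then q else fine (mu (A i))))%:E)%E.
Proof.
case: iid => mX muX indep mF F0 Fq.
have q0 : 0 <= q by rewrite -lee_fin -Fq integral_ge0// => x _; rewrite lee_fin.
elim => [|k IH] A mA.
  transitivity (\int[P]_w (\1_(\bigcap_(i in [set: 'I_N]) (X i @^-1` A i)) w)%:E)%E.
    apply: eq_integral => w _; congr (_%:E); rewrite indicE.
    have [/set_mem h|/negP h] := boolP (w \in _).
      by apply: big1 => i _ /=; rewrite indicE mem_set//; exact: h.
    have [i hi] : exists i, ~ A i (X i w).
      by apply: contrapT => /forallNP g; apply: h; rewrite inE => i _; apply: contrapT; exact: g.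
    by rewrite (bigD1 i)//= indicE memNset// mul0r.
  rewrite integral_indic ?setIT//; last first.
    apply: fin_bigcap_measurable => // i _.
    by rewrite -[X in measurable X]setTI; exact: mX.
  rewrite [LHS](indep A mA) -prodEFin; apply: eq_bigr => i _.
  by rewrite muX// fineK// fin_num_measure.
have [kN|kN] := ltnP k N; last first.
  have e (i : 'I_N) : (i < k.+1)%N = (i < k)%N.
    by rewrite (leq_trans (ltn_ord i) kN) (leq_trans (ltn_ord i) (leqW kN)).
  under eq_integral do under eq_bigr do rewrite e.
  by under [in RHS]eq_bigr do rewrite e; exact: IH.
pose i0 := Ordinal kN.
have e (i : 'I_N) : i != i0 -> (i < k.+1)%N = (i < k)%N.
  by move=> h; rewrite ltnS leq_eqVlt -[k]/(val i0) val_eqE (negbTE h).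
pose G w := \prod_(i < N | i != i0) (if (i < k)%N then F (X i w) else \1_(A i) (X i w)).
pose c := \prod_(i < N | i != i0) (if (i < k)%N then q else fine (mu (A i))).
have -> : \prod_(i < N) (if (i < k.+1)%N then q else fine (mu (A i))) = c * q.
  rewrite (bigD1 i0)//= ltnSn mulrC; congr (_ * _).
  by apply: eq_bigr => i hi; rewrite e.
rewrite EFinM -Fq.
transitivity (\int[P]_w (G w * F (X i0 w))%:E)%E.
  apply: eq_integral => w _; rewrite (bigD1 i0)//= ltnSn mulrC; congr (_ * _)%:E.
  by apply: eq_bigr => i hi; rewrite e.
apply: ge0_integral_factor => //.
- rewrite /G; under eq_fun do rewrite big_mkcond/=.
  apply: measurable_prod => i _ /=; case: (i != i0) => /=; last exact: measurable_cst.
  case: (i < k)%N => /=; first exact: (measurableT_comp mF (mX i)).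
  by apply: measurableT_comp (mX i); exact: measurable_indic.
- by move=> w; apply: prodr_ge0 => i _; case: ifP => _.
- by apply: prodr_ge0 => i _; case: ifP => _//; exact: fine_ge0.
(* The indicator identity for coordinate [i0] is the induction hypothesis with [B] placed at
   [i0]. *)
move=> B mB; pose A' i := if i == i0 then B else A i.
have mA' i : measurable (A' i) by rewrite /A'; case: ifP.
have Ec : \prod_(i < N) (if (i < k)%N then q else fine (mu (A' i))) =
    c * fine (mu B).
  rewrite (bigD1 i0)//= ltnn /A' eqxx mulrC; congr (_ * _).
  by apply: eq_bigr => i hi; rewrite (negbTE hi).
transitivity ((c * fine (mu B))%:E); last by rewrite EFinM fineK// fin_num_measure.
rewrite -Ec -(IH A' mA').
apply: eq_integral => w _; rewrite [in RHS](bigD1 i0)//= ltnn /A' eqxx mulrC.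
by congr (_ * _)%:E; apply: eq_bigr => i hi; rewrite (negbTE hi).
Qed.

Lemma integral_prod_iid (F : Rn R n -> R) (q : R) :
  measurable_fun setT F -> (forall x, 0 <= F x) -> (\int[mu]_x (F x)%:E = q%:E)%E ->
  (\int[P]_w (\prod_(i < N) F (X i w))%:E = (q ^+ N)%:E)%E.
Proof.
move=> mF F0 Fq; transitivity ((\prod_(i < N) q)%:E)%E; last first.
  by rewrite prodr_const card_ord.
have := integral_prod_iid_rec mF F0 Fq N (A := fun=> setT) (fun=> measurableT).
under eq_integral do under eq_bigr do rewrite ltn_ord.
by under [in X in _ = X -> _]eq_bigr do rewrite ltn_ord.
Qed.

Lemma integral_marginal (F : Rn R n -> R) i :
  measurable_fun setT F -> (forall x, 0 <= F x) ->
  (\int[P]_w (F (X i w))%:E = \int[mu]_x (F x)%:E)%E.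
Proof.
case: iid => mX muX _ mF F0; rewrite -[RHS]mul1e.
under eq_integral do rewrite -[F _]mul1r.
apply: (@ge0_integral_factor _ _ _ _ _ _ mu (X i) (cst 1) 1) => //.
move=> A mA; rewrite mul1e; transitivity (P (X i @^-1` A)); last exact: muX.
under eq_integral do rewrite mul1r.
rewrite -[in RHS](setIT (_ @^-1` _)) -integral_indic//.
by rewrite -[X in measurable X]setTI; exact: mX.
Qed.

End iid.

(* [E] has outer measure at most [p]; the events below need not be measurable. *)
Definition small {R : realType} {d} {T : measurableType d} (P : probability T R)
    (E : set T) (p : R) :=
  exists B, [/\ measurable B, E `<=` B & (P B <= p%:E)%E].

Section small.
Context {R : realType} {d : measure_display} {T : measurableType d}.
Context (P : probability T R).
Implicit Types (E : set T) (p q : R).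

Lemma small_le E E' p p' : E `<=` E' -> p' <= p -> small P E' p' -> small P E p.
Proof.
move=> EE pp [B [mB EB Bp]]; exists B; split => //; first exact: subset_trans EB.
by rewrite (le_trans Bp)// lee_fin.
Qed.

Lemma small0 p : 0 <= p -> small P set0 p.
Proof. by move=> p0; exists set0; split => //; rewrite measure0 lee_fin. Qed.

Lemma smallU E E' p p' : small P E p -> small P E' p' -> small P (E `|` E') (p + p').
Proof.
move=> [B [mB EB Bp]] [B' [mB' EB' Bp']]; exists (B `|` B'); split.
- exact: measurableU.
- exact: setUSS.
- by rewrite EFinD (le_trans (measureU2 _ mB mB'))// leeD.
Qed.

Lemma small_bigcup (E : nat -> set T) (p : nat -> R) q :
  (forall s, small P (E s) (p s)) -> (forall m, \sum_(s < m) p s <= q) ->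
  small P (\bigcup_s E s) q.
Proof.
move=> h pq; have [B hB] := choice h.
exists (\bigcup_s B s); split.
- by apply: bigcup_measurable => s _; case: (hB s).
- by apply: subset_bigcup => s _; case: (hB s).
rewrite (le_trans (measure_sigma_subadditive P (F := B) _ _ _))//.
- by move=> s; case: (hB s).
- by apply: bigcup_measurable => s _; case: (hB s).
apply: lime_le; first by apply: is_cvg_nneseries => s _ _; exact: measure_ge0.
apply: nearW => m; rewrite big_mkord (le_trans (y := (\sum_(s < m) p s)%:E))//.
  by rewrite -sumEFin; apply: lee_sum => s _; case: (hB s).
by rewrite lee_fin.
Qed.

Lemma small_seq (I : eqType) (s : seq I) (E : I -> set T) p :
  0 <= p -> (forall i, i \in s -> small P (E i) p) ->
  small P [set w | exists2 i, i \in s & E i w] ((size s)%:R * p).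
Proof.
move=> p0; elim: s => [_|i s IH h].
  by apply: small_le (small0 (lexx 0)) => [w [i]|]; rewrite ?mul0r.
apply: small_le (smallU (h i (mem_head _ _)) (IH _)); last 2 first.
- by rewrite /= -add1n natrD mulrDl mul1r.
- by move=> j js; apply: h; rewrite inE js orbT.
move=> w [j]; rewrite inE => /orP[/eqP->|js] Ejw; [by left|by right; exists j].
Qed.

Lemma small_markov E (F : T -> R) p m : measurable_fun setT F ->
  (forall w, 0 <= F w) -> 0 < m -> (forall w, E w -> m <= F w) ->
  (\int[P]_w (F w)%:E <= p%:E)%E -> small P E (p / m).
Proof.
move=> mF F0 m0 EF Fp; exists [set w | m <= F w]; split.
- rewrite -[X in measurable X]setTI; apply: measurable_fun_le => //.
- by move=> w /EF.
have mB : measurable [set w | m <= F w].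
  by rewrite -[X in measurable X]setTI; exact: measurable_fun_le.
rewrite EFinM lee_pdivlMr// (le_trans _ Fp)// muleC.
rewrite -[X in (_ * P X)%E]setIT -integral_indic//.
have mI : measurable_fun setT (fun w => (\1_[set w | m <= F w] w : R)%:E).
  by apply/measurable_EFinP; exact: measurable_indic.
rewrite -ge0_integralZl_EFin//; last exact: ltW.
apply: ge0_le_integral => //.
- by move=> w _; rewrite -EFinM lee_fin mulr_ge0// ltW.
- by apply/measurable_EFinP/measurable_funM => //; exact: measurable_indic.
- exact/measurable_EFinP.
- move=> w _; rewrite -EFinM lee_fin indicE.
  by have [/set_mem|_] := boolP (w \in _); rewrite ?mulr1 ?mulr0.
Qed.

End small.

(** * Marginals of isotropic log-concave measures *)

Lemma sum_geometric_half {R : realFieldType} m :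
  \sum_(k < m) (2^-1 : R) ^+ k <= 2.
Proof.
suff -> : \sum_(k < m) (2^-1 : R) ^+ k = 2 - 2 * 2^-1 ^+ m.
  by rewrite gerBl mulr_ge0// exprn_ge0.
elim: m => [|m IH]; first by rewrite big_ord0 expr0; lra.
by rewrite big_ord_recr/= IH exprS; lra.
Qed.

Section log_concave_marginals.
Context {R : realType} {n : nat} (mu : probability (Rn R n) R).
Hypotheses (iso : isotropic mu) (lc : log_concave mu) (sym : symmetric_measure mu).
Context (y : 'rV[R]_n) (y0 : y != 0).

Let H (u : R) : set (Rn R n) := [set x | u <= dot x y].
Let g (u : R) : R := fine (mu (H u)).

Local Lemma mH u : measurable (H u).
Proof.
rewrite -[H u]setTI; apply: measurable_fun_le => //; exact: measurable_dot.
Qed.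

Local Lemma gE u : mu (H u) = (g u)%:E.
Proof. by rewrite /g fineK// fin_num_measure//; exact: mH. Qed.

Local Lemma g_ge0 u : 0 <= g u. Proof. exact: fine_ge0. Qed.

Local Lemma g_le1 u : g u <= 1.
Proof. by rewrite -lee_fin -gE probability_le1//; exact: mH. Qed.

Local Lemma g_le u v : u <= v -> g v <= g u.
Proof.
move=> uv; rewrite -lee_fin -!gE le_measure ?inE//; [exact: mH|exact: mH|].
by move=> x /=; exact: le_trans.
Qed.

(** A convex combination of the half-spaces [H u] and [H v] lies in the half-space at the combined
    level; they are nonempty because [y] is nonzero. *)
Local Lemma g_logconcave l u v : 0 < l -> l < 1 ->
  g u `^ l * g v `^ (1 - l) <= g (l * u + (1 - l) * v).
Proof.
move=> l0 l1; rewrite -lee_fin -gE.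
have ne w : H w !=set0.
  exists ((w / norm2 y ^+ 2) *: y); rewrite /H/= dotZl -sqr_norm2 divfK//.
  by rewrite sqrf_eq0 gt_eqF// norm2_gt0.
apply: (lc l0 l1 (mH u) (mH v) (ne u) (ne v) (mH _)) => a b /= ha hb.
change (l * u + (1 - l) * v <= dot (l *: (a : 'rV[R]_n) + (1 - l) *: (b : 'rV[R]_n)) y).
by rewrite dotDl !dotZl lerD// ler_wpM2l// ?subr_ge0 ltW.
Qed.

Local Lemma g_midpoint u v : g u * g v <= g ((u + v) / 2) ^+ 2.
Proof.
have l0 : 0 < 2^-1 :> R by lra.
have l1 : 2^-1 < 1 :> R by lra.
have half : 1 - 2^-1 = 2^-1 :> R by lra.
have := g_logconcave u v l0 l1; rewrite half -mulrDr [2^-1 * (u + v)]mulrC => h.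
rewrite (_ : g u * g v = (g u `^ 2^-1 * g v `^ 2^-1) ^+ 2).
  by rewrite lerXn2r// nnegrE ?mulr_ge0 ?powR_ge0 ?g_ge0.
by rewrite !powR12_sqrt ?g_ge0// exprMn !sqr_sqrtr ?g_ge0.
Qed.

Local Lemma measure_reflection (A B : set (Rn R n)) : measurable A ->
  (forall x : 'rV[R]_n, A x <-> B (- x)) -> mu B = mu A.
Proof.
move=> mA AB; rewrite -(sym mA); congr (mu _); apply/seteqP; split => x.
  by move=> Bx; exists (- (x : 'rV[R]_n)); rewrite ?opprK//; apply/AB; rewrite opprK.
by move=> [z Az <-]; exact/AB.
Qed.

Local Lemma g0_ge : 2^-1 <= g 0.
Proof.
pose H' : set (Rn R n) := [set x | dot x y <= 0].
have H'0 : mu H' = mu (H 0).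
  apply: measure_reflection => [|x]; first exact: mH.
  by rewrite /H /H' /= dotNl oppr_le0.
have mH' : measurable H'.
  rewrite -[H']setTI; apply: measurable_fun_le => //; exact: measurable_dot.
have : (1%:E <= (g 0)%:E + (g 0)%:E :> \bar R)%E.
  rewrite -gE -[X in (_ + X)%E]H'0 -(probability_setT mu).
  rewrite (_ : setT = H 0 `|` H'); first exact: measureU2 (mH 0) mH'.
  apply/seteqP; split => // x _; rewrite /H /H' /=.
  by case/orP: (le_total 0 (dot x y)); [left|right].
by rewrite -EFinD lee_fin; lra.
Qed.

(** By log-concavity the ratios of consecutive tails do not increase, and the first one is at most
    [8^-1 / 2^-1], since symmetry gives [g 0] at least one half. *)
Local Lemma g_decay a k : 0 < a -> g a <= 8^-1 -> g (k%:R * a) <= 4^-1 ^+ k.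
Proof.
move=> a0 ga.
have step j : g (j.+1%:R * a) <= g (j%:R * a) / 4.
  elim: j => [|j IH]; first by rewrite mul1r mul0r; have := g0_ge; lra.
  have := g_midpoint (j.+2%:R * a) (j%:R * a).
  have -> : (j.+2%:R * a + j%:R * a) / 2 = j.+1%:R * a by rewrite -!natr1; field.
  have : g (j.+2%:R * a) <= g (j%:R * a).
    by apply: g_le; rewrite ler_pM2r// ler_nat -addn2 leq_addr.
  move: IH (g_ge0 (j%:R * a)) (g_ge0 (j.+1%:R * a)) (g_ge0 (j.+2%:R * a)).
  set p := g (j%:R * a); set q := g (j.+1%:R * a); set s := g _ => qp p0 q0 s0 sp spq.
  have [p00|p00] := eqVneq p 0; first by lra.
  have {p00}p0' : 0 < p by rewrite lt_def p00.
  rewrite -(ler_pM2r p0') (le_trans spq)//; nra.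
elim: k => [|k IH]; first by rewrite expr0 g_le1.
by rewrite (le_trans (step k))// exprSr ler_pM2r ?invr_gt0.
Qed.

Local Lemma two_sided k a : 0 < a -> g a <= 8^-1 ->
  (mu [set x | (k%:R * a <= `|dot x y|)%R ] <= (2 * 4^-1 ^+ k)%:E)%E.
Proof.
move=> a0 ga; pose H' : set (Rn R n) := [set x | dot x y <= - (k%:R * a)].
have H'E : mu H' = mu (H (k%:R * a)).
  apply: measure_reflection => [|x]; first exact: mH.
  by rewrite /H /H' /= dotNl lerN2.
have mH' : measurable H'.
  rewrite -[H']setTI; apply: measurable_fun_le => //; exact: measurable_dot.
have hk : (mu (H (k%:R * a)) <= (4^-1 ^+ k)%:E)%E by rewrite gE lee_fin g_decay.
have hk' : (mu H' <= (4^-1 ^+ k)%:E)%E by rewrite H'E.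
rewrite (_ : [set _ | _] = H (k%:R * a) `|` H').
  apply: (le_trans (measureU2 _ (mH _) mH')).
  by rewrite [2 * _]mulr_natl mulr2n EFinD; exact: leeD.
apply/seteqP; split => x; rewrite /H /H' /= ler_normr lerNr.
  by move=> /orP[]; [left|right].
by case=> ->; rewrite ?orbT.
Qed.

(* Layer-cake: were the tail mass at |y|/4 below 1/8, geometric decay would
   force the second moment below |y|^2. *)
Local Lemma g_quarter : 8^-1 <= g (norm2 y / 4).
Proof.
rewrite leNgt; apply/negP => /ltW ga.
have [a aE] : exists a, a = norm2 y / 4 by eexists.
rewrite -aE in ga; have a0 : 0 < a by rewrite aE divr_gt0// norm2_gt0.
pose A k : set (Rn R n) := [set x | k%:R * a <= `|dot x y| ].
have mA k : measurable (A k).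
  rewrite -[A k]setTI; apply: measurable_fun_le => //.
  by apply: measurableT_comp => //; exact: measurable_dot.
(* The odd numbers up to [2 * m + 1] add up to [(m + 1) ^ 2], so the sum of the [f k] dominates the
   square of [dot x y]. *)
pose f k (x : Rn R n) : \bar R := (a ^+ 2 * (k.*2.+1)%:R * \1_(A k) x)%:E.
have f0 k x : (0 <= f k x)%E by rewrite lee_fin mulr_ge0 ?indicE// mulr_ge0 ?sqr_ge0.
have mf k : measurable_fun setT (f k).
  rewrite /f; apply/measurable_EFinP; apply: measurable_funM => //.
have fk k : (\int[mu]_x f k x <= (a ^+ 2 * 4 * 2^-1 ^+ k)%:E)%E.
  rewrite /f; under eq_integral do rewrite EFinM.
  rewrite ge0_integralZl_EFin//; last 2 first.
  - by apply/measurable_EFinP; exact: measurable_indic.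
  - by rewrite mulr_ge0// sqr_ge0.
  rewrite integral_indic// setIT (le_trans (lee_pmul _ _ (lexx _) (two_sided k a0 ga)))//.
    by rewrite lee_fin mulr_ge0// sqr_ge0.
  rewrite -EFinM lee_fin.
  suff : (k.*2.+1)%:R * (2 * 4^-1 ^+ k) <= 4 * 2^-1 ^+ k :> R.
    by move=> /(ler_wpM2l (sqr_ge0 a)); rewrite !mulrA.
  have k2 : (k.*2.+1)%:R <= 2 * 2 ^+ k :> R.
    rewrite -natrX -natrM ler_nat; elim: k {f0 mf} => [//|k IH].
    rewrite doubleS expnS; have : (0 < 2 ^ k)%N by rewrite expn_gt0.
    by move: IH; set q := (2 ^ k)%N; lia.
  have e : (4^-1 : R) ^+ k = 2^-1 ^+ k * 2^-1 ^+ k by rewrite -exprMn; congr (_ ^+ _); lra.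
  have e' : (2 : R) ^+ k * 2^-1 ^+ k = 1 by rewrite -exprMn divff// expr1n.
  have p0 : 0 <= (2^-1 : R) ^+ k by rewrite exprn_ge0.
  rewrite e; move: p0 k2 e'; set p := 2^-1 ^+ k; set q := 2 ^+ k; set r := (k.*2.+1)%:R.
  move=> p0 rq qp; apply: (@le_trans _ _ ((2 * q) * (2 * (p * p)))).
    by rewrite ler_wpM2r// !mulr_ge0.
  have -> : (2 * q) * (2 * (p * p)) = 4 * (q * p) * p by ring.
  by rewrite qp mulr1.
(* As [a] is a quarter of the norm, the right side is half of the left one: the contradiction. *)
have : ((norm2 y ^+ 2)%:E <= (8 * a ^+ 2)%:E)%E.
  rewrite -iso (@le_trans _ _ (\int[mu]_x \sum_(k <oo) f k x)%E)//.
    apply: ge0_le_integral => //.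
    - by move=> x _; rewrite lee_fin sqr_ge0.
    - by apply/measurable_EFinP; apply: measurable_funX; exact: measurable_dot.
    - apply: ge0_emeasurable_sum => // k x _ _; exact: f0.
    move=> x _; pose m := Num.truncn (`|dot x y| / a).
    have /andP[m1 m2] : m%:R <= `|dot x y| / a < m.+1%:R.
      by apply: truncn_itv; rewrite divr_ge0// ltW.
    rewrite (le_trans _ (nneseries_lim_ge m.+1 _))//.
    rewrite /f sumEFin; under eq_big_nat => k km.
      rewrite (_ : \1_(A k) x = 1); last first.
        rewrite indicE mem_set// /A/= -ler_pdivlMr// (le_trans _ m1)// ler_nat.
        by move: km; lia.
      rewrite mulr1; over.
    rewrite -mulr_sumr lee_fin -real_normK ?num_real//.
    have -> : \sum_(0 <= k < m.+1) (k.*2.+1)%:R = m.+1%:R ^+ 2 :> R.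
      elim: (m.+1) => [|j IH]; first by rewrite big_geq// expr0n.
      by rewrite big_nat_recr//= IH -!natr1 -mul2n natrM; ring.
    have ma : `|dot x y| <= a * m.+1%:R by rewrite mulrC -ler_pdivrMr// ltW.
    by rewrite -exprMn lerXn2r// nnegrE (le_trans _ ma).
  rewrite integral_nneseries//.
  apply: lime_le; first by apply: is_cvg_nneseries => k _ _; exact: integral_ge0.
  apply: nearW => m; rewrite big_mkord.
  rewrite (@le_trans _ _ (\sum_(k < m) (a ^+ 2 * 4 * 2^-1 ^+ k)%:E)%E)//.
    by apply: lee_sum => k _; exact: fk.
  rewrite sumEFin lee_fin -mulr_sumr.
  have := @sum_geometric_half R m; have := sqr_ge0 a; nra.
by rewrite lee_fin aE; have := norm2_gt0 y0; set s := norm2 y; nra.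
Qed.

(** The level [s] lies between [- s] and [a], with weight [th = 2 * s / (a + s)] on [a].
    Log-concavity and [8^-1 <= g a] then bound [g s] below by [(1 - 7 * th) * g (- s)], so the slab
    has mass at most [7 * th], hence at most [112 * t]. *)
Lemma small_ball_marginal t : 0 < t ->
  (mu [set x | (`|dot x y| <= t * norm2 y)%R ] <= (112 * t)%:E)%E.
Proof.
move=> t0; have yp := norm2_gt0 y0.
have mB s : measurable [set x : Rn R n | `|dot x y| <= s].
  rewrite -[X in measurable X]setTI; apply: measurable_fun_le => //.
  by apply: measurableT_comp => //; exact: measurable_dot.
have [t8|t8] := leP (8^-1) t.
  rewrite (le_trans (probability_le1 mu (mB _)))// lee_fin; lra.
(* Doubling the half-width puts the closed slab inside the difference of the two closed half-spaces
   [H (- s)] and [H s]. *)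
set a := norm2 y / 4; pose s := 2 * t * norm2 y.
have sa : s < a by rewrite /s /a; nra.
have s0 : 0 < s by rewrite !mulr_gt0.
have a0 : 0 < a by rewrite divr_gt0.
rewrite (@le_trans _ _ (mu (H (- s) `\` H s)))//.
  rewrite le_measure ?inE//; first by apply: measurableD; exact: mH.
  move=> x /=; rewrite ler_norml => /andP[h1 h2]; rewrite /H/=; split.
    by rewrite (le_trans _ h1)// lerN2 /s; nra.
  by apply/negP; rewrite -ltNge (le_lt_trans h2)// /s; nra.
have -> : mu (H (- s) `\` H s) = (g (- s) - g s)%:E.
  transitivity (mu (H (- s)) - mu (H s))%E; last by rewrite !gE.
  rewrite measureD; [|exact: mH|exact: mH|].
    rewrite (_ : H (- s) `&` H s = H s)//.
    by apply/setIidPr => x; rewrite /H/=; apply: le_trans; lra.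
  by rewrite -ge0_fin_numE// fin_num_measure//; exact: mH.
rewrite lee_fin.
pose th := 2 * s / (a + s).
have as0 : 0 < a + s by lra.
have th0 : 0 < th by rewrite divr_gt0// mulr_gt0.
have th1 : th < 1 by rewrite ltr_pdivrMr//; lra.
have := @g_logconcave (1 - th) (- s) a; rewrite (_ : 1 - (1 - th) = th); last by lra.
rewrite (_ : (1 - th) * - s + th * a = s); last by rewrite /th; field; lra.
rewrite subr_gt0 gtrBl => /(_ th1 th0) h.
have h1 : g (- s) <= g (- s) `^ (1 - th).
  have [->|g0] := eqVneq (g (- s)) 0; first by rewrite powR_ge0.
  rewrite -{1}(powRr1 (g_ge0 (- s))).
  by apply: ger_powR; rewrite ?g_le1 ?andbT ?lt_def ?g0 ?g_ge0//; lra.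
(* [8 ^ (- th)] is at least [1 - th * ln 8], and [ln (1 + 7) <= 7]. *)
have h2 : 1 - 7 * th <= g a `^ th.
  rewrite (@le_trans _ _ (8^-1 `^ th))//; last first.
    by rewrite ge0_ler_powR ?nnegrE ?g_ge0 ?g_quarter// ltW.
  rewrite /powR ifF; last by apply/negbTE; lra.
  rewrite (le_trans _ (expR_ge1Dx _))// lnV ?posrE//.
  have : ln (1 + 7) <= (7 : R) by apply: le_ln1Dx; lra.
  rewrite (_ : 1 + 7 = 8) => [l8|]; last by lra.
  nra.
have h3 : th <= 2 * s / a.
  by rewrite ler_pM2l ?mulr_gt0// lef_pV2 ?posrE//; lra.
have h4 : 7 * (2 * s / a) = 112 * t by rewrite /s /a; field; rewrite gt_eqF.
rewrite -h4.
have gs0 := g_ge0 (- s); have gs1 := g_le1 (- s).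
have [q|q] := leP (1 - 7 * th) 0; last first.
  have : g (- s) * (1 - 7 * th) <= g s.
    by rewrite (le_trans _ h)// ler_pM// ltW.
  nra.
have := g_ge0 s; nra.
Qed.

End log_concave_marginals.

(** * Tails of the sampling operator *)

Section sampling_tails.
Context {R : realType} {n N : nat} {d : measure_display} {T : measurableType d}.
Context (P : probability T R) (mu : probability (Rn R n) R).
Context (X : 'I_N -> T -> Rn R n) (iid : iid_law P mu X).

Definition Gam (w : T) (z : 'rV[R]_n) : 'rV[R]_N := sampling (fun i => X i w) z.

(** [D] is a member of the set whose infimum is the [psi2] norm of [dot z]; with members, attainment
    of the infimum is never at issue. *)
Definition subgaussian (z : 'rV[R]_n) (D : R) : Prop :=
  0 < D /\ (\int[mu]_x (expR (dot z x ^+ 2 / D ^+ 2))%:E <= 2%:E)%E.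

Lemma measurable_sqr_Gam z : measurable_fun setT (fun w => norm2 (Gam w z) ^+ 2).
Proof.
case: iid => mX _ _; rewrite /Gam; under eq_fun do rewrite sqr_norm2_sampling.
apply: measurable_sum => i; apply: measurable_funX.
by have := measurableT_comp (measurable_dot z) (mX i).
Qed.

Lemma measurable_expR_dot s (z : 'rV[R]_n) :
  measurable_fun setT (fun x : Rn R n => expR (s * dot x z ^+ 2)).
Proof.
apply: measurableT_comp => //; apply: measurable_funM => //.
by apply: measurable_funX; exact: measurable_dot.
Qed.

(** The squared norm is a sum over the sample, so its exponential factors by independence. Positive
    [s] serves the upper tail and negative [s] the small ball estimate. *)
Lemma expR_moment_Gam s z q :
  (\int[mu]_x (expR (s * dot x z ^+ 2))%:E <= q%:E)%E ->
  (\int[P]_w (expR (s * norm2 (Gam w z) ^+ 2))%:E <= (q ^+ N)%:E)%E.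
Proof.
set I := (\int[mu]_x _)%E => Iq.
have I0 : (0 <= I)%E by apply: integral_ge0 => x _; rewrite lee_fin expR_ge0.
have If : I \is a fin_num by rewrite ge0_fin_numE// (le_lt_trans Iq)// ltry.
rewrite /Gam; under eq_integral do rewrite sqr_norm2_sampling mulr_sumr expR_sum.
rewrite (integral_prod_iid iid (q := fine I) (measurable_expR_dot s z))//.
- rewrite lee_fin lerXn2r// ?nnegrE ?fine_ge0//; last by rewrite -lee_fin fineK.
  by rewrite -lee_fin (le_trans I0).
- exact/esym/fineK.
Qed.

Lemma small_subgaussian z D u : subgaussian z D -> 0 <= u ->
  small P [set w | u * D < norm2 (Gam w z)] (2 ^+ N * expR (- u ^+ 2)).
Proof.
move=> [D0 zD] u0; rewrite expRN.
apply: (@small_markov _ _ _ _ _ (fun w => expR (D ^- 2 * norm2 (Gam w z) ^+ 2))).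
- apply: measurableT_comp => //; apply: measurable_funM => //.
  exact: measurable_sqr_Gam.
- by move=> w; exact: expR_ge0.
- exact: expR_gt0.
- move=> w /= /ltW h; rewrite ler_expR mulrC ler_pdivlMr ?exprn_gt0// -exprMn.
  by rewrite lerXn2r// nnegrE ?norm2_ge0// mulr_ge0// ltW.
- apply: expR_moment_Gam; under eq_integral do rewrite mulrC dotC.
  exact: zD.
Qed.

Lemma expR1_le4 : expR 1 <= 4 :> R.
Proof.
have : expR 2^-1 <= 2 :> R.
  have := expRxMexpNx_1 (2^-1 : R); have := expR_ge1Dx (- 2^-1 : R).
  have := @expR_gt0 R 2^-1; set p := expR _; set q := expR _ => p0 q1 pq.
  have : 0 <= p * (q - 2^-1) by rewrite mulr_ge0 ?(ltW p0)//; lra.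
  lra.
move=> h; have -> : expR 1 = expR 2^-1 * expR 2^-1 :> R by rewrite -expRD [in LHS](splitr 1) mul1r.
 have := @expR_gt0 R 2^-1; nra.
Qed.

Section isotropic_log_concave.
Hypotheses (iso : isotropic mu) (lc : log_concave mu) (sym : symmetric_measure mu).

(** One coordinate has negative exponential moment at most [112 * t + t ^+ 2]: the slab has mass
    [112 * t], and off it the exponent is at most [- t ^- 2], whose exponential is at most [t ^+ 2].
    On the event the product is at least [expR (- N%:R)], so Markov costs a factor 4 per coordinate,
    and [4 * 113 <= 512]. *)
Lemma small_small_ball z t : z != 0 -> 0 < t -> t <= 1 -> (0 < N)%N ->
  small P [set w | norm2 (Gam w z) <= t ^+ 2 * Num.sqrt N%:R * norm2 z]
    ((512 * t) ^+ N).
Proof.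
move=> z0 t0 t1 N0; have zp := norm2_gt0 z0.
set s := - ((t ^+ 2 * norm2 z) ^- 2).
have sp : 0 < (t ^+ 2 * norm2 z) ^+ 2 by rewrite exprn_gt0// mulr_gt0// exprn_gt0.
have s0 : s < 0 by rewrite oppr_lt0 invr_gt0.
apply: (@small_le _ _ _ _ _ _ _ ((113 * t) ^+ N / expR (- N%:R)) (@subset_refl _ _)).
  rewrite expRN invrK -[N%:R]mulr1 mulrC expRM_natl -exprMn.
  have e0 := @expR_gt0 R 1; have e4 := expR1_le4.
  by apply: lerXn2r; rewrite ?nnegrE; nra.
apply: (@small_markov _ _ _ _ _ (fun w => expR (s * norm2 (Gam w z) ^+ 2))).
- apply: measurableT_comp => //; apply: measurable_funM => //.
  exact: measurable_sqr_Gam.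
- by move=> w; exact: expR_ge0.
- exact: expR_gt0.
- move=> w /= h; rewrite ler_expR /s mulNr lerN2 mulrC ler_pdivrMr//.
  have -> : N%:R * (t ^+ 2 * norm2 z) ^+ 2 = (t ^+ 2 * Num.sqrt N%:R * norm2 z) ^+ 2.
    by rewrite -[N%:R in LHS]sqr_sqrtr//; set q := Num.sqrt _; ring.
  by rewrite lerXn2r// nnegrE ?norm2_ge0// (le_trans _ h)// norm2_ge0.
apply: expR_moment_Gam.
pose A : set (Rn R n) := [set x | `|dot x z| <= t * norm2 z].
have mA : measurable A.
  rewrite -[A]setTI; apply: measurable_fun_le => //.
  by apply: measurableT_comp => //; exact: measurable_dot.
have mI : measurable_fun setT (fun x => (\1_A x : R)%:E) by apply/measurable_EFinP.
apply: (@le_trans _ _ (\int[mu]_x ((\1_A x : R)%:E + (t ^+ 2)%:E))%E).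
  apply: ge0_le_integral => //.
  - by apply/measurable_EFinP; exact: measurable_expR_dot.
  - exact: emeasurable_funD.
  move=> x _; rewrite -EFinD lee_fin indicE.
  have [_|/negP h] := boolP (x \in A).
    rewrite (@le_trans _ _ 1) ?lerDl ?sqr_ge0// -expR0 ler_expR.
    by rewrite nmulr_rle0// sqr_ge0.
  have {}h : t * norm2 z < `|dot x z| by rewrite ltNge; apply/negP => g; apply: h; rewrite inE.
  rewrite add0r -[t ^+ 2]invrK -[expR _]invrK lef_pV2 ?posrE ?invr_gt0 ?expR_gt0 ?exprn_gt0//.
  rewrite -expRN (le_trans _ (expR_ge1Dx _))// -[leLHS]add0r lerD// /s mulNr opprK.
  rewrite mulrC ler_pdivlMr// -[X in _ <= X]real_normK ?num_real//.
  have -> : t ^- 2 * (t ^+ 2 * norm2 z) ^+ 2 = (t * norm2 z) ^+ 2.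
    by rewrite !exprMn; field; rewrite gt_eqF.
  have tz : 0 <= t * norm2 z by rewrite mulr_ge0// ltW.
  by rewrite lerXn2r// ?nnegrE// ltW.
rewrite ge0_integralD//; last by move=> x _; rewrite lee_fin sqr_ge0.
rewrite integral_indic// setIT integral_cst// [X in (_ * X)%E]probability_setT mule1.
rewrite (le_trans (leeD (small_ball_marginal iso lc sym z0 t0) (lexx _)))//.
by rewrite -EFinD lee_fin; nra.
Qed.

(** Chebyshev's inequality. The polynomial rate suffices because it is applied with [l] at least the
    allowed size of the net. *)
Lemma small_second_moment z l : 0 < l -> (0 < N)%N ->
  small P [set w | l * Num.sqrt N%:R * norm2 z < norm2 (Gam w z)] (l ^- 2).
Proof.
move=> l0 N0.
have [->|z0] := eqVneq z 0.
  apply: (small_le _ _ (small0 P (lexx 0))); last by rewrite invr_ge0 sqr_ge0.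
  move=> w /=; rewrite /Gam sampling0 !norm2_0 mulr0.
  by rewrite ltxx.
have zp := norm2_gt0 z0.
have m0 : 0 < (l * Num.sqrt N%:R * norm2 z) ^+ 2.
  by rewrite exprn_gt0// !mulr_gt0// sqrtr_gt0 ltr0n.
have -> : l ^- 2 = N%:R * norm2 z ^+ 2 / (l * Num.sqrt N%:R * norm2 z) ^+ 2.
  have Nr : N%:R != 0 :> R by rewrite pnatr_eq0 -lt0n.
  rewrite exprMn [(l * _) ^+ 2]exprMn [Num.sqrt N%:R ^+ 2]sqr_sqrtr//.
  move: Nr (lt0r_neq0 zp) (lt0r_neq0 l0); set q := N%:R; set r := norm2 z => q0 r0 l1.
  by field; rewrite q0 r0.
apply: (@small_markov _ _ _ _ _ (fun w => norm2 (Gam w z) ^+ 2)) => //.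
- exact: measurable_sqr_Gam.
- by move=> w; exact: sqr_ge0.
- move=> w /= /ltW h; rewrite lerXn2r// nnegrE ?norm2_ge0//.
  by rewrite !mulr_ge0 ?sqrtr_ge0 ?norm2_ge0// ltW.
rewrite /Gam; under eq_integral do rewrite sqr_norm2_sampling -sumEFin.
have mF : measurable_fun setT (fun x : Rn R n => dot x z ^+ 2).
  by apply: measurable_funX; exact: measurable_dot.
rewrite ge0_integral_sum//; last 2 first.
- move=> i; case: iid => mX _ _; apply/measurable_EFinP.
  by have := measurableT_comp mF (mX i).
- by move=> i w _; rewrite lee_fin sqr_ge0.
have e (i : 'I_N) : (\int[P]_w (dot (X i w) z ^+ 2)%:E = (norm2 z ^+ 2)%:E)%E.
  by rewrite (integral_marginal iid i mF) ?iso// => x; exact: sqr_ge0.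
rewrite (eq_bigr _ (fun i _ => e i)) sumEFin sumr_const card_ord lee_fin.
by rewrite mulr_natl.
Qed.

End isotropic_log_concave.
End sampling_tails.

(** * Subgaussian directions and [gamma2] *)

Section subgaussian.
Context {R : realType} {n : nat} (mu : probability (Rn R n) R).

Lemma measurable_expR_dotl (z : 'rV[R]_n) D :
  measurable_fun setT (fun x : Rn R n => expR (dot z x ^+ 2 / D ^+ 2)).
Proof.
have := measurable_expR_dot (D ^+ 2)^-1 z.
by under [X in measurable_fun _ X -> _]eq_fun do rewrite mulrC dotC.
Qed.

Lemma subgaussian_le z D D' : D <= D' -> subgaussian mu z D -> subgaussian mu z D'.
Proof.
move=> DD [D0 h]; have D'0 : 0 < D' := lt_le_trans D0 DD; split => //.
apply: le_trans h; apply: ge0_le_integral => //.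
- by apply/measurable_EFinP; exact: measurable_expR_dotl.
- by apply/measurable_EFinP; exact: measurable_expR_dotl.
move=> x _; rewrite lee_fin ler_expR ler_wpM2l ?sqr_ge0//.
by rewrite lef_pV2 ?posrE ?exprn_gt0// lerXn2r// nnegrE ltW.
Qed.

Lemma psi2dist_lt x y D : (psi2dist mu x y < D%:E)%E -> subgaussian mu (x - y) D.
Proof.
move=> /ereal_inf_lt [_ [C [C0 hC] <-]]; rewrite lte_fin => CD.
exact: (subgaussian_le (ltW CD)).
Qed.

Lemma psi2dist_ge0 x y : (0 <= psi2dist mu x y)%E.
Proof. by apply/ereal_infP => _ [C [C0 _] <-]; rewrite lee_fin ltW. Qed.

(** A triangle inequality up to a factor 2, from [(f - g) ^+ 2 <= 2 * (f ^+ 2 + g ^+ 2)] and the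
    arithmetic-geometric mean inequality for the exponentials. *)
Lemma subgaussianB z z' D D' : subgaussian mu z D -> subgaussian mu z' D' ->
  subgaussian mu (z - z') (2 * (D + D')).
Proof.
move=> [D0 h] [D'0 h']; split; first by rewrite mulr_gt0// addr_gt0.
set F := fun x : Rn R n => expR (dot z x ^+ 2 / D ^+ 2).
set F' := fun x : Rn R n => expR (dot z' x ^+ 2 / D' ^+ 2).
have mF : measurable_fun setT (fun x => (F x)%:E).
  by apply/measurable_EFinP; exact: measurable_expR_dotl.
have mF' : measurable_fun setT (fun x => (F' x)%:E).
  by apply/measurable_EFinP; exact: measurable_expR_dotl.
apply: (@le_trans _ _ (\int[mu]_x ((2^-1)%:E * ((F x)%:E + (F' x)%:E)))%E).
  apply: ge0_le_integral => //.
  - by apply/measurable_EFinP; exact: measurable_expR_dotl.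
  - by apply: measurable_funeM; exact: emeasurable_funD.
  move=> x _; rewrite -EFinD -EFinM lee_fin /F /F' dotDl dotNl.
  set f := dot z x; set g := dot z' x.
  set a := f ^+ 2 / D ^+ 2; set b := g ^+ 2 / D' ^+ 2.
  have hab : (f - g) ^+ 2 / (2 * (D + D')) ^+ 2 <= 2^-1 * (a + b).
    have s0 : 0 < D + D' by rewrite addr_gt0.
    have hs : (D + D') ^+ 2 * (a + b) >= f ^+ 2 + g ^+ 2.
      have fa : f ^+ 2 = D ^+ 2 * a by rewrite /a; field; rewrite gt_eqF.
      have gb : g ^+ 2 = D' ^+ 2 * b by rewrite /b; field; rewrite gt_eqF.
      have a0 : 0 <= a by rewrite divr_ge0 ?sqr_ge0.
      have b0 : 0 <= b by rewrite divr_ge0 ?sqr_ge0.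
      by rewrite fa gb mulrDr lerD// ler_wpM2r// lerXn2r// ?nnegrE ?ltW//; lra.
    rewrite ler_pdivrMr ?exprn_gt0 ?mulr_gt0// exprMn.
    have : (f - g) ^+ 2 <= 2 * (f ^+ 2 + g ^+ 2) by have := sqr_ge0 (f + g); nra.
    by move: hs; set S := (D + D') ^+ 2; nra.
  apply: (@le_trans _ _ (expR (2^-1 * (a + b)))); first by rewrite ler_expR.
  rewrite mulrDr expRD.
  have ea : expR a = expR (2^-1 * a) ^+ 2.
    by rewrite expr2 -expRD; congr expR; field.
  have eb : expR b = expR (2^-1 * b) ^+ 2.
    by rewrite expr2 -expRD; congr expR; field.
  rewrite ea eb; set p := expR _; set q := expR _.
  by have := sqr_ge0 (p - q); nra.
have F0 x : (0 <= (F x)%:E)%E by rewrite lee_fin expR_ge0.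
have F'0 x : (0 <= (F' x)%:E)%E by rewrite lee_fin expR_ge0.
rewrite ge0_integralZl_EFin//; last 2 first.
- by move=> x _; rewrite adde_ge0.
- exact: emeasurable_funD.
rewrite ge0_integralD//.
rewrite (le_trans (lee_pmul _ _ (lexx _) (leeD h h')))//.
- by rewrite adde_ge0// integral_ge0.
- by rewrite -EFinD -EFinM lee_fin; lra.
Qed.

(** Integrate [1 + u <= expR u]; isotropy turns the second moment into the Euclidean norm. *)
Lemma subgaussian_norm2 z D : isotropic mu -> subgaussian mu z D -> norm2 z <= D.
Proof.
move=> iso [D0 h].
have mq : measurable_fun setT (fun x : Rn R n => (dot x z ^+ 2)%:E).
  by apply/measurable_EFinP; apply: measurable_funX; exact: measurable_dot.
have i0 : 0 <= (D ^+ 2)^-1 by rewrite invr_ge0 sqr_ge0.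
have : ((norm2 z ^+ 2 / D ^+ 2 + 1)%:E <= 2%:E)%E.
  have e1 : (\int[mu]_x (1%:E : \bar R) = 1%:E)%E.
    by rewrite integral_cst// [X in (_ * X)%E]probability_setT mule1.
  have mD : measurable_fun setT (fun x : Rn R n => ((D ^- 2)%:E * (dot x z ^+ 2)%:E)%E).
    exact: measurable_funeM.
  have pD (x : Rn R n) : (0 <= (D ^- 2)%:E * (dot x z ^+ 2)%:E)%E.
    by rewrite -EFinM lee_fin mulr_ge0// sqr_ge0.
  apply: le_trans h; rewrite EFinD mulrC EFinM -iso -[X in (_ + X <= _)%E]e1.
  rewrite -ge0_integralZl_EFin//; last by move=> x _; rewrite lee_fin sqr_ge0.
  rewrite -ge0_integralD//.
  apply: ge0_le_integral => //.
  - by move=> x _; rewrite adde_ge0.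
  - exact: emeasurable_funD.
  - by apply/measurable_EFinP; exact: measurable_expR_dotl.
  - move=> x _; rewrite -EFinM -EFinD lee_fin dotC mulrC addrC.
    exact: expR_ge1Dx.
rewrite lee_fin => h1.
have : norm2 z ^+ 2 <= D ^+ 2 by rewrite -[leRHS]mul1r -ler_pdivrMr ?exprn_gt0//; lra.
by rewrite ler_pXn2r// nnegrE ?norm2_ge0// ltW.
Qed.

(* Since the infimum in the psi2 norm is only approached, the tail bound for all
   admissible [D] at once loses a factor 2. *)
Lemma small_all_subgaussian N d (T : measurableType d) (P : probability T R)
    (X : 'I_N -> T -> Rn R n) z u :
  iid_law P mu X -> isotropic mu -> 0 <= u ->
  small P [set w | exists2 D, subgaussian mu z D & 2 * u * D < norm2 (Gam X w z)]
    (2 ^+ N * expR (- u ^+ 2)).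
Proof.
move=> iid iso u0.
have p0 : 0 <= 2 ^+ N * expR (- u ^+ 2) :> R by rewrite mulr_ge0 ?exprn_ge0 ?expR_ge0.
have [->|z0] := eqVneq z 0.
  apply: (small_le _ _ (small0 P p0)) => // w /= [D [D0 _]].
  by rewrite /Gam sampling0 norm2_0 ltNge => /negP; apply; rewrite !mulr_ge0// ltW.
pose S := [set D | subgaussian mu z D].
have [[D1 D1S]|S0] := pselect (S !=set0); last first.
  by apply: (small_le _ _ (small0 P p0)) => // w /= [D hD _]; apply: S0; exists D.
have lbS : lbound S (norm2 z) by move=> D; exact: subgaussian_norm2.
have hi : has_inf S by split; [exists D1|exists (norm2 z)].
have i0 : 0 < inf S.
  by rewrite (lt_le_trans (norm2_gt0 z0))// lb_le_inf//; exists D1.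
(* With the infimum itself as tolerance, [D2] is below twice every admissible [D], so its single
   tail event covers them all. *)
have [D2 D2S D2i] := inf_adherent i0 hi.
apply: (small_le _ (lexx _) (small_subgaussian iid D2S u0)) => w /= [D DS].
apply: le_lt_trans; rewrite mulrAC [leRHS]mulrC ler_wpM2l//.
have : inf S <= D by apply: ge_inf => //; exists (norm2 z).
lra.
Qed.

End subgaussian.

(** Chooses a near-optimal admissible sequence and near-nearest points in it. The distances to the
    nets need not be attained; the slack that makes them so adds up to [2 * G], whence the constant
    3. *)
Lemma gamma2_nets {R : realType} {n} (mu : probability (Rn R n) R)
    (K : set 'rV[R]_n) (G : R) :
  (gamma2 K (psi2dist mu) < G%:E)%E ->
  exists (L : nat -> seq 'rV[R]_n) (pi : nat -> 'rV[R]_n -> 'rV[R]_n)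
    (C : nat -> 'rV[R]_n -> R) (t0 : 'rV[R]_n),
  (forall s, size (L s) <= 2 ^ (2 ^ s))%N /\
  forall t, K t -> [/\ pi 0%N t = t0,
    forall s, [/\ pi s t \in L s, K (pi s t) & subgaussian mu (t - pi s t) (C s t)] &
    forall m, \sum_(s < m) Num.sqrt 2 ^+ s * C s t <= 3 * G].
Proof.
move=> /ereal_inf_lt [_ [A [AK [[t0 At0] Af]] <-]] supG.
have sq0 s : 0 < Num.sqrt 2 ^+ s :> R by rewrite exprn_gt0// sqrtr_gt0.
have dge0 t s : (0 <= setdist (psi2dist mu) t (A s))%E.
  by apply/ereal_infP => _ [u _ <-]; exact: psi2dist_ge0.
have sumG t : K t -> forall m,
    (\sum_(0 <= s < m) (Num.sqrt 2 ^+ s)%:E * setdist (psi2dist mu) t (A s) <= G%:E)%E.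
  move=> Kt m; rewrite ltW// (le_lt_trans _ supG)//.
  apply: (@le_trans _ _ (\sum_(0 <= s <oo) (Num.sqrt 2 ^+ s)%:E *
      setdist (psi2dist mu) t (A s))%E).
    by apply: nneseries_lim_ge => s _ _; rewrite mule_ge0// lee_fin ltW.
  by apply: ereal_sup_ubound; exists t.
have /choice[L hL] : forall s, exists L : seq 'rV[R]_n,
    (size L <= 2 ^ (2 ^ s))%N /\ forall a, A s a -> a \in L.
  move=> s; have [f hf] := Af s; exists (codom f); split.
    by rewrite size_codom card_ord.
  by move=> a /hf [i _ <-]; exact: codom_f.
have [[t1 Kt1]|K0] := pselect (K !=set0); last first.
  exists L, (fun _ t => t), (fun _ _ => 0), t0; split.
    by move=> s; case: (hL s).
  by move=> t Kt; exfalso; apply: K0; exists t.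
have dfin t s : K t -> setdist (psi2dist mu) t (A s) \is a fin_num.
  move=> Kt; rewrite ge0_fin_numE//; have := sumG t Kt s.+1.
  rewrite big_nat_recr//= => h; rewrite ltey; apply/eqP => e; move: h.
  rewrite e gt0_muley ?lte_fin// addey ?leye_eq//.
  by rewrite gt_eqF// (lt_le_trans ltNy0)// sume_ge0// => i _; rewrite mule_ge0// lee_fin ltW.
have G0 : 0 <= G by rewrite -lee_fin; have := sumG t1 Kt1 0; rewrite big_geq.
(* The slack below must be positive; [G = 0] is excluded because the strict bound [G] lies above a
   supremum of nonnegative sums. *)
have [Gp|G0'] := ltP 0 G; last first.
  have sG : (ereal_sup [set \sum_(0 <= s <oo) (Num.sqrt 2 ^+ s)%:E *
      setdist (psi2dist mu) t (A s) | t in K] >= 0)%E.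
    apply: (@le_trans _ _ (\sum_(0 <= s <oo) (Num.sqrt 2 ^+ s)%:E *
      setdist (psi2dist mu) t1 (A s))%E).
      by apply: nneseries_ge0 => s _ _; rewrite mule_ge0// lee_fin ltW.
    by apply: ereal_sup_ubound; exists t1.
  by have := le_lt_trans sG supG; rewrite lte_fin ltNge G0'.
pose C s t := fine (setdist (psi2dist mu) t (A s)) + G * 2^-1 ^+ s / Num.sqrt 2 ^+ s.
(* Membership in [K] sits under the existential so that choice gives a total map; outside [K] its
   value is arbitrary. *)
have hpi (q : nat * 'rV[R]_n) : exists a, K q.2 -> A q.1 a /\ (psi2dist mu q.2 a < (C q.1 q.2)%:E)%E.
  have [Kt|nK] := pselect (K q.2); last by exists 0.
  have : (setdist (psi2dist mu) q.2 (A q.1) < (C q.1 q.2)%:E)%E.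
    rewrite -(fineK (dfin q.2 q.1 Kt)) lte_fin /C ltrDl.
    by rewrite divr_gt0// mulr_gt0// exprn_gt0.
  by move=> /ereal_inf_lt [_ [a Aa <-] h]; exists a.
have [p hp] := choice hpi.
exists L, (fun s t => p (s, t)), C, t0; split.
  by move=> s; case: (hL s).
move=> t Kt; split.
- by have [h _] := hp (0%N, t) Kt; exact: At0.
- move=> s; have [h1 h2] := hp (s, t) Kt; split.
  + by case: (hL s) => _; apply.
  + exact: (AK s).
  + exact: psi2dist_lt.
move=> m.
have -> : \sum_(s < m) Num.sqrt 2 ^+ s * C s t =
    \sum_(s < m) Num.sqrt 2 ^+ s * fine (setdist (psi2dist mu) t (A s)) +
    G * \sum_(s < m) 2^-1 ^+ s.
  rewrite mulr_sumr -big_split; apply: eq_bigr => s _ /=.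
  by rewrite /C mulrDr; congr (_ + _); rewrite mulrC divfK// gt_eqF.
have -> : 3 * G = G + G * 2 by ring.
apply: lerD; last by rewrite ler_wpM2l// sum_geometric_half.
rewrite -lee_fin -sumEFin; have := sumG t Kt m; rewrite big_mkord; apply: le_trans.
by apply: lee_sum => s _; rewrite EFinM fineK//; exact: dfin.
Qed.

(** * Chaining and multiscale nets *)

Section chaining.
Context {R : realType} {n N : nat} {d : measure_display} {T : measurableType d}.
Context (P : probability T R) (mu : probability (Rn R n) R).
Context (X : 'I_N -> T -> Rn R n).
Context (L : nat -> seq 'rV[R]_n) (s0 : nat).

(** The event refers to pairs of net points rather than to links of a chain, so it is a countable
    union. Levels start at [s0], where [2 ^ s] is comparable with [N] and the Gaussian gain absorbs
    [2 ^+ N]. *)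
Definition bad_chaining (v : R) : set T := [set w | exists s, (s0 <= s)%N /\
  exists2 a, a \in L s.+1 & exists2 b, b \in L s &
  exists2 D, subgaussian mu (a - b) D &
    2 * (v * Num.sqrt 2 ^+ s) * D < norm2 (Gam X w (a - b))].

Lemma expRN_le_inv (x : R) : 0 < x -> expR (- x) <= x^-1.
Proof.
move=> x0; rewrite expRN lef_pV2 ?posrE ?expR_gt0//.
by rewrite (le_trans _ (expR_ge1Dx _))//; lra.
Qed.

Lemma ler_expR1_pow m : 2 ^+ m <= expR m%:R :> R.
Proof.
rewrite -[m%:R]mulr1 expRM_natl lerXn2r// ?nnegrE ?expR_ge0//.
by rewrite (le_trans _ (expR_ge1Dx _)).
Qed.

(** The two net sizes and [2 ^+ N] together have exponent below [131 * 2 ^ s], against a gain of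
    [1024 * 16 ^ k * 2 ^ s]; the surplus is used through [expR (- u) <= u^-1], squared. *)
Lemma chaining_probability k s : (N < 128 * 2 ^ s)%N ->
  (2 ^ 2 ^ s.+1)%:R * ((2 ^ 2 ^ s)%:R *
    (2 ^+ N * expR (- (32 * 4 ^+ k * Num.sqrt 2 ^+ s) ^+ 2))) <=
  256^-1 ^+ k * 2^-1 ^+ s :> R.
Proof.
move=> Ns; have e : (32 * 4 ^+ k * Num.sqrt 2 ^+ s) ^+ 2 = 1024 * 16 ^+ k * 2 ^+ s :> R.
  have e1 : (Num.sqrt 2 ^+ s) ^+ 2 = 2 ^+ s :> R.
    by rewrite -exprM mulnC exprM sqr_sqrtr.
  have e2 : (4 ^+ k) ^+ 2 = 16 ^+ k :> R.
    by rewrite -exprM mulnC exprM; congr (_ ^+ k); ring.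
  by rewrite exprMn [(32 * _) ^+ 2]exprMn e1 e2; congr (_ * _ * _); ring.
rewrite e !natrX !mulrA -!exprD.
set x := 16 ^+ k; set y := 2 ^+ s.
have x1 : 1 <= x by rewrite exprn_ege1// ler1n.
have y1 : 1 <= y by rewrite exprn_ege1// ler1n.
apply: (@le_trans _ _ (expR (131 * y) * expR (- (1024 * x * y)))).
  rewrite ler_wpM2r ?expR_ge0// (le_trans (ler_expR1_pow _))// ler_expR.
  rewrite /y -natrX -natrM ler_nat expnS.
  by move: Ns; set q := (2 ^ s)%N; lia.
rewrite -expRD; apply: (@le_trans _ _ (expR (- (x * y)) ^+ 2)).
  by rewrite expr2 -expRD ler_expR; nra.
have xy0 : 0 < x * y by nra.
apply: (@le_trans _ _ ((x * y)^-1 ^+ 2)).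
  by apply: lerXn2r; rewrite ?nnegrE ?expR_ge0 ?invr_ge0 ?(ltW xy0)//; exact: expRN_le_inv.
have -> : 256^-1 ^+ k = x^-1 ^+ 2 :> R.
  by rewrite /x -!exprVn -exprM mulnC exprM; congr (_ ^+ _); field.
rewrite invfM exprMn ler_wpM2l ?sqr_ge0// exprVn -/y.
rewrite expr2 ger_pMr ?invr_gt0 ?invf_le1//; lra.
Qed.

Lemma small_bad_chaining k :
  iid_law P mu X -> isotropic mu ->
  (forall s, size (L s) <= 2 ^ (2 ^ s))%N -> (N < 128 * 2 ^ s0)%N ->
  small P (bad_chaining (32 * 4 ^+ k)) (2 * 256^-1 ^+ k).
Proof.
move=> iid iso sL Ns0; set v := 32 * 4 ^+ k.
have v0 : 0 <= v by rewrite mulr_ge0// exprn_ge0.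
pose E s : set T := [set w | (s0 <= s)%N /\
  exists2 a, a \in L s.+1 & exists2 b, b \in L s &
  exists2 D, subgaussian mu (a - b) D &
    2 * (v * Num.sqrt 2 ^+ s) * D < norm2 (Gam X w (a - b))].
apply: (@small_le _ _ _ _ _ (\bigcup_s E s) _ (2 * 256^-1 ^+ k)) => //.
  by move=> w [s h]; exists s.
apply: (@small_bigcup _ _ _ _ _ (fun s => 256^-1 ^+ k * 2^-1 ^+ s)); last first.
  move=> m; rewrite -mulr_sumr mulrC ler_wpM2r ?exprn_ge0//.
  exact: sum_geometric_half.
move=> s; have p0 : 0 <= 256^-1 ^+ k * 2^-1 ^+ s :> R by rewrite mulr_ge0// exprn_ge0.
have [ss|ss] := leqP s0 s; last first.
  by apply: (small_le _ _ (small0 P p0)) => // w [h]; exfalso; lia.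
have u0 : 0 <= v * Num.sqrt 2 ^+ s by rewrite mulr_ge0// exprn_ge0// sqrtr_ge0.
have q0 : 0 <= 2 ^+ N * expR (- (v * Num.sqrt 2 ^+ s) ^+ 2) :> R.
  by rewrite mulr_ge0 ?exprn_ge0 ?expR_ge0.
have Ns : (N < 128 * 2 ^ s)%N.
  by rewrite (leq_trans Ns0)// leq_mul2l leq_exp2l.
apply: (small_le _ (le_trans _ (chaining_probability k Ns)) (small_seq (s := L s.+1)
  (E := fun a => [set w | exists2 b, b \in L s & exists2 D, subgaussian mu (a - b) D &
    2 * (v * Num.sqrt 2 ^+ s) * D < norm2 (Gam X w (a - b))])
  (p := (size (L s))%:R * (2 ^+ N * expR (- (v * Num.sqrt 2 ^+ s) ^+ 2))) _ _)).
- by move=> w [_].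
- rewrite -/v; apply: ler_pM => //; rewrite ?mulr_ge0// ?ler_nat ?sL//.
  by rewrite ler_wpM2r// ler_nat.
- by rewrite mulr_ge0.
move=> a aL; apply: small_seq => // b bL; exact: small_all_subgaussian.
Qed.

Context (K : set 'rV[R]_n) (G : R) (pi : nat -> 'rV[R]_n -> 'rV[R]_n).
Context (C : nat -> 'rV[R]_n -> R).

(** Off the bad event the links from level [s0] to [s0 + m] telescope to at most [24 * v * G]. For
    [m] large in terms of the sample, the crude operator bound leaves at most [v * G] for the
    rest. *)
Lemma chaining_bound (v : R) w t : isotropic mu -> 0 < v -> 0 <= G -> ~ bad_chaining v w ->
  (forall s, pi s t \in L s /\ subgaussian mu (t - pi s t) (C s t)) ->
  (forall m, \sum_(s < m) Num.sqrt 2 ^+ s * C s t <= 3 * G) ->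
  norm2 (Gam X w (t - pi s0 t)) <= 25 * v * G.
Proof.
move=> iso v0 G0 good hpi hC.
have sq0 s : 0 < Num.sqrt 2 ^+ s :> R by rewrite exprn_gt0// sqrtr_gt0.
have sq1 : 1 <= Num.sqrt 2 :> R by rewrite -[leLHS]sqrtr1 ler_wsqrtr// ler1n.
have C0 s : 0 < C s t by case: (hpi s) => _ [].
pose c s := Num.sqrt 2 ^+ s * C s t.
have c0 s : 0 <= c s by rewrite mulr_ge0 ?ltW.
have step s : (s0 <= s)%N ->
    norm2 (Gam X w (pi s.+1 t - pi s t)) <= 4 * v * (c s + c s.+1).
  move=> ss; have [l1 g1] := hpi s.+1; have [l2 g2] := hpi s.
  have g := subgaussianB g2 g1.
  have e : t - pi s t - (t - pi s.+1 t) = pi s.+1 t - pi s t.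
    by rewrite opprB addrCA addrAC subrr add0r addrC.
  rewrite e in g.
  have : norm2 (Gam X w (pi s.+1 t - pi s t)) <=
      2 * (v * Num.sqrt 2 ^+ s) * (2 * (C s t + C s.+1 t)).
    rewrite leNgt; apply/negP => h; apply: good; exists s; split => //.
    exists (pi s.+1 t) => //; exists (pi s t) => //.
    by exists (2 * (C s t + C s.+1 t)).
  move=> /le_trans; apply.
  have -> : 2 * (v * Num.sqrt 2 ^+ s) * (2 * (C s t + C s.+1 t)) =
      4 * v * (Num.sqrt 2 ^+ s * C s t + Num.sqrt 2 ^+ s * C s.+1 t) by ring.
  rewrite ler_wpM2l//; first by rewrite mulr_ge0// ltW.
  rewrite lerD// ler_wpM2r//; first exact: ltW.
  by rewrite ler_weXn2l.
have tele m : norm2 (Gam X w (pi (s0 + m)%N t - pi s0 t)) <=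
    4 * v * \sum_(i < m) (c (s0 + i)%N + c (s0 + i).+1).
  elim: m => [|m IH].
    by rewrite addn0 subrr /Gam sampling0 norm2_0 big_ord0 mulr0.
  rewrite big_ord_recr/= mulrDr addnS.
  rewrite -(subrKA (pi (s0 + m)%N t)) addrC /Gam samplingD.
  by rewrite (le_trans (norm2D _ _))// lerD// step// leq_addr.
have sumc m : \sum_(i < m) (c (s0 + i)%N + c (s0 + i).+1) <= 6 * G.
  have h1 : \sum_(i < m) c (s0 + i)%N <= 3 * G.
    apply: le_trans (hC (s0 + m)%N); rewrite big_split_ord/= lerDr.
    by apply: sumr_ge0 => i _; exact: c0.
  have h2 : \sum_(i < m) c (s0 + i).+1 <= 3 * G.
    apply: le_trans (hC (s0.+1 + m)%N); rewrite big_split_ord/= -[leLHS]add0r lerD//.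
    by apply: sumr_ge0 => i _; exact: c0.
  by rewrite big_split/=; lra.
have [l l0 hl] := sampling_bounded (fun i => X i w).
(* An even [m] turns the power of [Num.sqrt 2] into a power of 2, which exceeds its own exponent. *)
pose m := (2 * (Num.truncn (l * 3 / v)).+1)%N.
have mbig : l * 3 / v <= Num.sqrt 2 ^+ (s0 + m)%N.
  apply: (@le_trans _ _ (Num.sqrt 2 ^+ m)); last first.
    by rewrite ler_weXn2l// leq_addl.
  rewrite /m exprM sqr_sqrtr// -natrX.
  have h0 : 0 <= l * 3 / v by rewrite divr_ge0 ?mulr_ge0// ltW.
  have /andP[_ /ltW h] := truncn_itv h0.
  by rewrite (le_trans h)// ler_nat; exact/ltnW/ltn_expl.
have far : norm2 (Gam X w (t - pi (s0 + m)%N t)) <= v * G.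
  rewrite (le_trans (hl _))//.
  have [_ /(subgaussian_norm2 iso) h] := hpi (s0 + m)%N.
  have hc : c (s0 + m)%N <= 3 * G.
    apply: le_trans (hC (s0 + m).+1); rewrite big_ord_recr/= lerDr.
    by apply: sumr_ge0 => i _; exact: c0.
  rewrite (le_trans (ler_wpM2l l0 h))//.
  move: mbig; rewrite ler_pdivrMr// => mbig.
  have : l * 3 * C (s0 + m)%N t <= 3 * G * v.
    apply: (@le_trans _ _ (c (s0 + m)%N * v)); last by rewrite ler_wpM2r// ltW.
    by rewrite /c [leRHS]mulrAC ler_wpM2r// ltW.
  nra.
rewrite -(subrKA (pi (s0 + m)%N t)) /Gam samplingD (le_trans (norm2D _ _))//.
have -> : 25 * v * G = v * G + 4 * v * (6 * G) by ring.
apply: lerD => //; apply: le_trans (tele m) _.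
by rewrite ler_wpM2l// mulr_ge0// ltW.
Qed.

End chaining.

(** * Nets of a symmetric convex set at all radii *)

Lemma size_flatten_le (I J : eqType) (f : I -> seq J) (s : seq I) m :
  (forall i, size (f i) <= m)%N -> (size (flatten (map f s)) <= size s * m)%N.
Proof. by move=> fm; elim: s => //= i s IH; rewrite size_cat mulSn leq_add. Qed.

Lemma grid_approx {R : realType} (x h : R) (m : nat) :
  0 <= x -> 0 < h -> x <= m%:R * h ->
  exists2 j, j \in iota 0 m.+1 & `|x - j%:R * h| <= h.
Proof.
move=> x0 h0 xm; have xh : 0 <= x / h by rewrite divr_ge0// ltW.
have /andP[j1 j2] := truncn_itv xh; exists (Num.truncn (x / h)).
  by rewrite mem_iota leq0n add0n ltnS /= -(ler_nat R) (le_trans j1)// ler_pdivrMr.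
move: j1 j2; rewrite ler_pdivlMr// ltr_pdivrMr// => j1 j2.
by rewrite ger0_norm ?subr_ge0// lerBlDl; move: j2; rewrite -natr1 mulrDl mul1r => /ltW.
Qed.

Section nets.
Context {R : realType} {n : nat} (K : set 'rV[R]_n).
Hypothesis K_convex : forall x y (t : R), K x -> K y -> 0 <= t -> t <= 1 ->
  K (t *: x + (1 - t) *: y).
Hypothesis K_sym : forall x, K x -> K (- x).

Lemma convex_half x y : K x -> K y -> K (2^-1 *: (x + y)).
Proof.
move=> Kx Ky; have := @K_convex x y 2^-1 Kx Ky.
have -> : 1 - 2^-1 = 2^-1 :> R by lra.
by rewrite scalerDr; apply; lra.
Qed.

Lemma convex_shrink (a : R) x : 0 <= a <= 1 -> K x -> K (a *: x).
Proof.
move=> /andP[a0 a1] Kx; have -> : a *: x = ((1 + a) / 2) *: x + (1 - (1 + a) / 2) *: - x.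
  by rewrite scalerN -scalerBl; congr (_ *: _); field.
by apply: K_convex => //; [exact: K_sym|lra|lra].
Qed.

Lemma convex_rescale x (s : R) : K x -> 0 <= s -> s <= norm2 x -> 0 < norm2 x ->
  K ((s / norm2 x) *: x) /\ norm2 ((s / norm2 x) *: x) = s.
Proof.
move=> Kx s0 sx x0; split.
  by apply: convex_shrink; rewrite // divr_ge0 ?norm2_ge0//= ler_pdivrMr// mul1r.
by rewrite norm2Z ger0_norm ?divr_ge0 ?norm2_ge0// divfK// gt_eqF.
Qed.

Context (r : R) (r0 : 0 < r) (A : seq 'rV[R]_n) (pi : 'rV[R]_n -> 'rV[R]_n).
Hypothesis piA : forall t, K t -> norm2 t = r ->
  [/\ pi t \in A, norm2 (pi t) = r & norm2 (t - pi t) <= r / 32].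

(** Shrink [x] to norm [r], approximate it there, and scale back: this costs [s / 32]. Rounding the
    norm to one of 17 multiples of [s / 16] costs [s / 16]. The point 0 serves vectors shorter than
    [r]. *)
Lemma net_centered (s : R) : 16 * r <= s ->
  exists2 Z : seq 'rV[R]_n, (size Z <= (17 * size A).+1)%N &
    forall x, K x -> norm2 x <= s -> exists2 c, c \in Z & norm2 (x - c) <= s / 8.
Proof.
have rp : 0 < r := r0.
move=> rs; have s0 : 0 < s by lra.
exists (0 :: [seq (j%:R * (s / 16) / r) *: a | j <- iota 0 17, a <- A]).
  by rewrite -cat1s size_cat size_allpairs size_iota.
move=> x Kx xs; have [xr|rx] := leP (norm2 x) r.
  by exists 0; rewrite ?mem_head// subr0; lra.
have x0 : 0 < norm2 x by lra.
have [Kt tr] := convex_rescale Kx (ltW r0) (ltW rx) x0.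
set t := (r / norm2 x) *: x in Kt tr.
have [pA pr pd] := piA Kt tr.
have [|||j jj hj] := @grid_approx R (norm2 x) (s / 16) 16.
- exact: norm2_ge0.
- lra.
- by rewrite mulrC divfK// pnatr_eq0.
exists ((j%:R * (s / 16) / r) *: pi t).
  by rewrite inE; apply/orP; right; apply/allpairsP; exists (j, pi t).
have -> : x - (j%:R * (s / 16) / r) *: pi t =
    (norm2 x / r) *: (t - pi t) + ((norm2 x - j%:R * (s / 16)) / r) *: pi t.
  rewrite scalerBr /t scalerA (_ : norm2 x / r * (r / norm2 x) = 1).
    by rewrite scale1r mulrBl scalerBl addrA subrK.
  by field; rewrite !gt_eqF.
have e1 : `|norm2 x / r| = norm2 x / r.
  by rewrite ger0_norm// divr_ge0 ?norm2_ge0// ltW.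
have e2 : `|(norm2 x - j%:R * (s / 16)) / r| * r = `|norm2 x - j%:R * (s / 16)|.
  by rewrite normrM normfV (gtr0_norm r0) divfK// gt_eqF.
rewrite (le_trans (norm2D _ _))// !norm2Z pr e1 e2.
have : norm2 x / r * norm2 (t - pi t) <= norm2 x / 32.
  rewrite (le_trans (ler_wpM2l _ pd))// ?divr_ge0 ?norm2_ge0 ?(ltW r0)//.
  by rewrite mulrA divfK// gt_eqF.
lra.
Qed.

(** The centre is moved to a point [y] of [K] in the ball, if there is one; then half of [x - y] is
    a vector of [K] of norm at most [s], and [net_centered] applies to it. *)
Lemma net_ball (s : R) c0 : 16 * r <= s ->
  exists2 Z : seq 'rV[R]_n, (size Z <= (17 * size A).+1)%N &
    forall x, K x -> norm2 (x - c0) <= s ->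
      exists2 c, c \in Z & norm2 (x - c) <= s / 4.
Proof.
have rp : 0 < r := r0.
move=> rs; have [[y [Ky yc]]|no] := pselect (exists y, K y /\ norm2 (y - c0) <= s).
  have [Z sZ hZ] := net_centered rs.
  exists [seq y + 2 *: c | c <- Z]; first by rewrite size_map.
  move=> x Kx xc.
  have Kd : K (2^-1 *: (x - y)) by apply: convex_half => //; exact: K_sym.
  have dn : norm2 (2^-1 *: (x - y)) <= s.
    rewrite norm2Z ger0_norm//.
    have -> : x - y = (x - c0) - (y - c0) by rewrite opprB addrA subrK.
    have := norm2B (x - c0) (y - c0); lra.
  have [c cZ hc] := hZ _ Kd dn; exists (y + 2 *: c); first exact: map_f.
  have -> : x - (y + 2 *: c) = 2 *: (2^-1 *: (x - y) - c).
    by rewrite scalerBr scalerA divff// scale1r opprD addrA.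
  by rewrite norm2Z ger0_norm//; lra.
by exists [::] => // x Kx xc; exfalso; apply: no; exists x.
Qed.

(** Each round refines every ball into balls of a quarter of its radius. The count per round does
    not depend on the scale. *)
Lemma net_multiscale j c0 :
  exists2 Z : seq 'rV[R]_n, (size Z <= (17 * size A).+1 ^ j)%N &
    forall x, K x -> norm2 (x - c0) <= 4 ^+ j * (16 * r) ->
      exists2 c, c \in Z & norm2 (x - c) <= 16 * r.
Proof.
have rp : 0 < r := r0.
elim: j c0 => [|j IH] c0.
  by exists [:: c0] => // x _ h; exists c0; rewrite ?mem_head//; move: h; rewrite expr0 mul1r.
have p1 : 1 <= 4 ^+ j :> R by rewrite exprn_ege1// ler1n.
have [|Z sZ hZ] := @net_ball (4 ^+ j.+1 * (16 * r)) c0; first by rewrite exprS; nra.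
have /choice[f hf] : forall c : 'rV[R]_n, exists l : seq 'rV[R]_n,
    (size l <= (17 * size A).+1 ^ j)%N /\
    forall x, K x -> norm2 (x - c) <= 4 ^+ j * (16 * r) ->
      exists2 c', c' \in l & norm2 (x - c') <= 16 * r.
  by move=> c; have [l h1 h2] := IH c; exists l.
exists (flatten (map f Z)).
  rewrite expnS (leq_trans (size_flatten_le _ (m := ((17 * size A).+1 ^ j)%N) _))//.
    by move=> c; case: (hf c).
  by rewrite leq_mul2r sZ orbT.
move=> x Kx xc; have [c cZ hc] := hZ x Kx xc.
have [|c' c'f hc'] := (hf c).2 x Kx.
  by rewrite (le_trans hc)// exprS; lra.
by exists c' => //; apply/flattenP; exists (f c) => //; exact: map_f.
Qed.

(* Rescaling [w + u] for a fixed long [u] in [K] writes a short [w] in [K] as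
   [alpha t - u] with [t] on the sphere of radius [r], where the chaining applies. *)
Lemma net_lemma j m x0 : K x0 -> 64 * r <= norm2 x0 -> (0 < m)%N ->
  exists2 Z : seq 'rV[R]_n,
    (size Z <= (17 * size A).+1 ^ j * (size A * (80 * m).+1))%N &
    forall x, K x -> norm2 x <= 4 ^+ j * (16 * r) ->
      exists z t al be, [/\ z \in Z, K t /\ norm2 t = r, 0 <= al <= 80,
        `|be| <= m%:R^-1 & x - z = 2 *: (al *: (t - pi t) + be *: pi t)].
Proof.
have rp : 0 < r := r0.
move=> Kx0 x0r m0.
have x0p : 0 < norm2 x0 by lra.
have [|Ku ur] := @convex_rescale x0 (64 * r) Kx0 _ x0r x0p; first lra.
set u := ((64 * r) / norm2 x0) *: x0 in Ku ur.
have [C sC hC] := net_multiscale j 0.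
(* Net centres may lie outside [K]; each useful one is represented by a point of [K], so that half
   differences stay in [K]. *)
have /choice[rep hrep] : forall c : 'rV[R]_n, exists y : 'rV[R]_n, forall x,
    K x -> norm2 (x - c) <= 16 * r -> K y /\ norm2 (y - c) <= 16 * r.
  move=> c; have [[y [Ky yc]]|no] := pselect (exists y, K y /\ norm2 (y - c) <= 16 * r).
    by exists y.
  by exists 0 => x Kx xc; exfalso; apply: no; exists x.
pose F c := [seq rep c + 2 *: ((i%:R * m%:R^-1) *: a - u) | i <- iota 0 (80 * m).+1, a <- A].
exists (flatten (map F C)).
  rewrite (leq_trans (size_flatten_le _ (m := (size A * (80 * m).+1)%N) _))//.
    by move=> c; rewrite size_allpairs size_iota mulnC.
  by rewrite leq_mul2r sC orbT.
move=> x Kx xr; have [|c cC xc] := hC x Kx; first by rewrite subr0.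
have [Ky yc] := hrep c x Kx xc; set y := rep c in Ky yc.
set w := 2^-1 *: (x - y).
have Kw : K w by apply: convex_half => //; exact: K_sym.
have wn : norm2 w <= 16 * r.
  rewrite norm2Z ger0_norm//.
  have -> : x - y = (x - c) - (y - c) by rewrite opprB addrA subrK.
  have := norm2B (x - c) (y - c); lra.
(* As [u] has norm [64 * r] and [w] at most [16 * r], [q] stays between [48 * r] and [80 * r]; half
   of [w + u] is thus long enough to be shrunk onto the sphere. *)
set q := norm2 (w + u).
have q1 : q <= 80 * r by have := norm2D w u; rewrite -/q ur; lra.
have q2 : 48 * r <= q.
  have := norm2B (w + u) w; rewrite -/q addrAC subrr add0r ur; lra.
have hn : norm2 (2^-1 *: (w + u)) = q / 2 by rewrite norm2Z ger0_norm// mulrC.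
have [|||Kt tr] := @convex_rescale (2^-1 *: (w + u)) r (convex_half Kw Ku); rewrite ?hn; [lra|lra|lra|].
rewrite hn in Kt tr; set t := _ *: _ in Kt tr.
have tE : w + u = (q / r) *: t.
  rewrite /t !scalerA (_ : q / r * (r / (q / 2)) / 2 = 1) ?scale1r//.
  by field; rewrite !gt_eqF//; lra.
have [pA pr pd] := piA Kt tr.
have mp : 0 < (m%:R : R)^-1 by rewrite invr_gt0 ltr0n.
have al0 : 0 <= q / r by rewrite divr_ge0//; lra.
have al80 : q / r <= 80 by rewrite ler_pdivrMr.
have [|i ii hi] := @grid_approx R (q / r) m%:R^-1 (80 * m) al0 mp.
  by rewrite natrM mulfK// pnatr_eq0 -lt0n.
exists (y + 2 *: ((i%:R * m%:R^-1) *: pi t - u)), t, (q / r), (q / r - i%:R * m%:R^-1).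
split => //.
- apply/flattenP; exists (F c); first exact: map_f.
  by apply/allpairsP; exists (i, pi t).
- by rewrite al0.
have -> : x - (y + 2 *: ((i%:R * m%:R^-1) *: pi t - u)) =
    2 *: (w + u - (i%:R * m%:R^-1) *: pi t).
  set B := _ *: pi t; have h2w : 2 *: w = x - y.
    by rewrite /w scalerA divff// scale1r.
  by rewrite !(scalerDr, scalerN) h2w !opprD !opprK !addrA addrAC.
by rewrite tE; congr (_ *: _); rewrite scalerBr scalerBl addrA subrK.
Qed.

End nets.

(** * Sections of K by the kernel *)

(** The union bound over the net of [net_lemma], with [2 ^ e] for the level size. [2 ^ (11 * N)] is
    the constant of the small ball estimate and [256 ^ k] the target probability; [16 <= k] absorbs
    the former. *)
Lemma count_bound k e N : (16 <= k)%N -> (64 * e <= N)%N -> (1000 <= N)%N ->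
  ((17 * 2 ^ e).+1 ^ (2 * k) * (2 ^ e * (80 * (2 ^ e * 16 ^ k)).+1) * 2 ^ (11 * N) * 256 ^ k
    <= 2 ^ (k * N))%N.
Proof.
move=> k16 eN N1000; have b0 : (0 < 2 ^ e)%N by rewrite expn_gt0.
have h1 : ((17 * 2 ^ e).+1 <= 2 ^ (5 + e))%N by rewrite expnD; move: b0; set b := (2 ^ e)%N; lia.
have h2 : ((80 * (2 ^ e * 16 ^ k)).+1 <= 2 ^ (7 + (e + 4 * k)))%N.
  have : (0 < 16 ^ k)%N by rewrite expn_gt0.
  rewrite 2!expnD [(2 ^ (4 * k))%N]expnM; move: b0.
  by set b := (2 ^ e)%N; rewrite -[(2 ^ 4)%N]/16%N; set q := (16 ^ k)%N; nia.
apply: (@leq_trans (2 ^ ((5 + e) * (2 * k)) * (2 ^ e * 2 ^ (7 + (e + 4 * k))) * 2 ^ (11 * N) * 256 ^ k)).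
  rewrite !leq_mul2r; do 2![apply/orP; right]; apply: leq_mul.
    by rewrite [(2 ^ (_ * (2 * k)))%N]expnM leq_exp2r//; lia.
  by rewrite leq_mul2l h2 orbT.
rewrite -[256%N]/(2 ^ 8)%N -expnM -!expnD leq_exp2l//; nia.
Qed.

Section kernel.
Context {R : realType} {n N : nat} {d : measure_display} {T : measurableType d}.
Context (P : probability T R) (mu : probability (Rn R n) R).
Context (X : 'I_N -> T -> Rn R n).
Hypotheses (iid : iid_law P mu X) (iso : isotropic mu) (lc : log_concave mu).
Hypothesis sym : symmetric_measure mu.
Context (K : set 'rV[R]_n).
Hypothesis K_convex : forall x y (t : R), K x -> K y -> 0 <= t -> t <= 1 ->
  K (t *: x + (1 - t) *: y).
Hypothesis K_sym : forall x, K x -> K (- x).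
Context (r : R).

Lemma kerGE w x : kerG X w x <-> Gam X w x = 0.
Proof.
split => [h|h i]; first by apply/rowP => i; rewrite !mxE h.
by move/rowP: h => /(_ i); rewrite !mxE.
Qed.

Context (L : nat -> seq 'rV[R]_n) (pi : nat -> 'rV[R]_n -> 'rV[R]_n).
Context (C : nat -> 'rV[R]_n -> R) (t0 : 'rV[R]_n).
(** 2048 exceeds [80 * 25]: the chaining constant 25 times the bound 80 on [al] in [net_lemma]. *)
Let G : R := Num.sqrt N%:R * (r / 2048).
Hypothesis L_size : forall s, (size (L s) <= 2 ^ (2 ^ s))%N.
Hypothesis piP : forall t, (K `&` sphere r) t -> [/\ pi 0%N t = t0,
  forall s, [/\ pi s t \in L s, (K `&` sphere r) (pi s t) &
     subgaussian mu (t - pi s t) (C s t)] &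
  forall m, \sum_(s < m) Num.sqrt 2 ^+ s * C s t <= 3 * G].

(** The antipodal points [t] and [- t] share the level 0 point [t0], so their distance [2 * r] is at
    most [6 * G]. *)
Lemma sample_size_large : 0 < r -> (K `&` sphere r) !=set0 -> (1000 <= N)%N.
Proof.
move=> rp [t [Kt tr]].
have tT : (K `&` sphere r) t by [].
have tT' : (K `&` sphere r) (- t) by split; [exact: K_sym|rewrite /sphere /= norm2N].
have [p1 /(_ 0%N) [_ _ /(subgaussian_norm2 iso) q1] /(_ 1%N) s1] := piP tT.
have [p2 /(_ 0%N) [_ _ /(subgaussian_norm2 iso) q2] /(_ 1%N) s2] := piP tT'.
rewrite big_ord1 expr0 mul1r in s1; rewrite big_ord1 expr0 mul1r in s2.
rewrite p1 in q1; rewrite p2 in q2.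
have := norm2B (t - t0) (- t - t0).
have -> : t - t0 - (- t - t0) = 2 *: t by rewrite scaler_nat mulr2n; apply/rowP => i; rewrite !mxE; ring.
rewrite norm2Z ger0_norm// tr => h.
have h2 : 600 <= Num.sqrt N%:R :> R.
  have : 2 * r <= 6 * G by lra.
  by rewrite /G; set q := Num.sqrt _ => {}h; rewrite -(ler_pM2l rp); nra.
rewrite -(ler_nat R) -[leRHS](@sqr_sqrtr R N%:R)//.
by move: h2; set q := Num.sqrt _ => h2; nra.
Qed.

(** Three failures are counted: chaining, a net point on the sphere with a huge image ([BA]), a long
    net point with a tiny image ([BZ]). A kernel vector [x] escaping the first two produces the
    third, at the net point [z] near [x]. *)
Lemma kernel_radius_small k : 0 < r -> (1000 <= N)%N -> (16 <= k)%N ->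
  small P [set w | exists x, [/\ K x, norm2 x = 16 ^+ k * (16 * r) & kerG X w x]]
    (4 * 256^-1 ^+ k).
Proof.
move=> rp N1000 k16; have N0 : (0 < N)%N by lia.
have ep : 0 <= 256^-1 ^+ k :> R by apply: exprn_ge0; rewrite invr_ge0 ler0n.
set rho := 16 ^+ k * (16 * r).
have [[x0 [Kx0 x0n]]|no] := pselect (exists x, K x /\ norm2 x = rho); last first.
  apply: (small_le _ _ (small0 P (lexx 0))); last by rewrite mulr_ge0.
  by move=> w [x [Kx xr _]]; apply: no; exists x.
pose s0 := trunc_log 2 (N %/ 64).
have /andP[Ns1 Ns2] : (2 ^ s0 <= N %/ 64 < 2 ^ s0.+1)%N by apply: trunc_log_bounds => //; lia.
have {}Ns1 : (64 * 2 ^ s0 <= N)%N by lia.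
have {}Ns2 : (N < 128 * 2 ^ s0)%N by move: Ns2; rewrite expnS; lia.
pose sq : R := Num.sqrt N%:R.
have sqN : sq ^+ 2 = N%:R by rewrite sqr_sqrtr.
have sqp : 0 < sq by rewrite sqrtr_gt0 ltr0n.
have G0 : 0 <= G by apply: mulr_ge0; [exact: ltW|apply: divr_ge0; [exact: ltW|exact: ler0n]].
have piA t : K t -> norm2 t = r ->
    [/\ pi s0 t \in L s0, norm2 (pi s0 t) = r & norm2 (t - pi s0 t) <= r / 32].
  move=> Kt tr; have [_ hs hsum] := piP (conj Kt tr : (K `&` sphere r) t).
  have [h1 [_ h2] h3] := hs s0; split => //.
  rewrite (le_trans (subgaussian_norm2 iso h3))//.
  set y := Num.sqrt 2 ^+ s0 : R.
  have yp : 0 < y by rewrite exprn_gt0// sqrtr_gt0.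
  have hC : y * C s0 t <= 3 * G.
    apply: le_trans (hsum s0.+1); rewrite big_ord_recr/= lerDr.
    apply: sumr_ge0 => i _; have [_ _ [c0 _]] := hs i.
    by rewrite mulr_ge0 ?exprn_ge0 ?sqrtr_ge0 ?(ltW c0).
  have sy : sq <= 12 * y.
    have n1 : sq \is Num.nneg by rewrite nnegrE ltW.
    have n2 : 12 * y \is Num.nneg by rewrite nnegrE mulr_ge0// ltW.
    rewrite -(ler_pXn2r (n := 2) isT n1 n2).
    have y2 : y ^+ 2 = (2 ^ s0)%:R by rewrite /y -exprM mulnC exprM sqr_sqrtr// natrX.
    rewrite sqN exprMn y2; apply: (@le_trans _ _ (128 * 2 ^ s0)%:R).
      by rewrite ler_nat ltnW.
    by rewrite natrM ler_wpM2r// ?ler0n//; lra.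
  rewrite -(ler_pM2l yp) (le_trans hC)// /G -/sq; nra.
(* The mesh [m%:R^-1] cancels the bound [m%:R * sq * r] on images of net points, while [b * m ^- 2]
   is at most [256 ^- k]. *)
pose b := (2 ^ (2 ^ s0))%N; pose m := (b * 16 ^ k)%N.
have b0 : (0 < b)%N by rewrite expn_gt0.
have m0 : (0 < m)%N by rewrite muln_gt0 b0 expn_gt0.
have e16 : 4 ^+ (2 * k) = 16 ^+ k :> R by rewrite exprM; congr (_ ^+ k); ring.
have p16 : 16 <= 16 ^+ k :> R.
  by rewrite -{1}[16]expr1 ler_weXn2l ?ler1n//; lia.
have [|Z sZ hZ] := @net_lemma R n K K_convex K_sym r rp (L s0) (pi s0) piA
    (2 * k) m x0 Kx0 _ m0.
  by rewrite x0n /rho; nra.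
rewrite e16 -/rho in hZ.
pose v : R := 32 * 4 ^+ k.
have v1 : 1 <= v.
  by have : 1 <= 4 ^+ k :> R by [rewrite exprn_ege1// ler1n]; rewrite /v; lra.
pose BA := [set w | exists2 a, a \in L s0 & norm2 a = r /\ m%:R * sq * r < norm2 (Gam X w a)].
pose BZ := [set w | exists2 z, z \in Z &
  rho / 2 <= norm2 z /\ norm2 (Gam X w z) <= 4 * v * r * sq].
have mR : 1 <= m%:R :> R by rewrite ler1n.
have smallA : small P BA (256^-1 ^+ k).
  have p0 : 0 <= (m%:R : R) ^- 2 by rewrite invr_ge0 sqr_ge0.
  have h := @small_seq _ _ _ P _ (L s0)
    (fun a => [set w | norm2 a = r /\ m%:R * sq * r < norm2 (Gam X w a)]) _ p0 _.
  apply: (small_le _ _ (h _)) => //.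
    have b1 : 1 <= b%:R :> R by rewrite ler1n.
    apply: (@le_trans _ _ (b%:R * m%:R ^- 2)); first by rewrite ler_wpM2r// ler_nat.
    rewrite ler_pdivrMr; last by rewrite exprn_gt0// ltr0n.
    rewrite /m natrM natrX exprMn mulrCA.
    have -> : 256^-1 ^+ k * (16 ^+ k) ^+ 2 = 1 :> R.
      rewrite -exprM mulnC exprM -exprMn (_ : 256^-1 * 16 ^+ 2 = 1); last by field.
      by rewrite expr1n.
    by rewrite mulr1 expr2 ler_peMr//; lra.
  move=> a _; have [ar|ar] := eqVneq (norm2 a) r; last first.
    by apply: (small_le _ _ (small0 P p0)) => // w [/eqP]; rewrite (negbTE ar).
  apply: (small_le _ (lexx _) (small_second_moment iid iso a _ N0)).
    by move=> w [_]; rewrite ar.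
  by rewrite ltr0n.
(* This value makes [t ^+ 2 * (rho / 2)] equal to [4 * v * r], so [BZ] falls under the small ball
   estimate. *)
have [t tE] : exists t : R, t = 4 * 2^-1 ^+ k by eexists.
have tp : 0 < t by rewrite tE mulr_gt0// exprn_gt0.
have t1 : t <= 1.
  rewrite tE -[k](@subnKC 2); last by apply: leq_trans k16.
  rewrite exprD mulrA (_ : 4 * 2^-1 ^+ 2 = 1); last by field.
  by rewrite mul1r; apply: exprn_ile1; lra.
have smallZ : small P BZ (256^-1 ^+ k).
  have p0 : 0 <= (512 * t) ^+ N.
    by apply: exprn_ge0; apply: mulr_ge0; [exact: ler0n|exact: ltW].
  have h := @small_seq _ _ _ P _ Z
    (fun z => [set w | rho / 2 <= norm2 z /\ norm2 (Gam X w z) <= 4 * v * r * sq]) _ p0 _.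
  apply: (small_le _ _ (h _)) => //.
    have cb := @count_bound k (2 ^ s0) N k16 Ns1 N1000.
    have sZb : (size Z * 2 ^ (11 * N) * 256 ^ k <= 2 ^ (k * N))%N.
      apply: leq_trans cb; rewrite !leq_mul2r; do 2![apply/orP; right].
      apply: (leq_trans sZ); apply: leq_mul.
        have hb : ((17 * size (L s0)).+1 <= (17 * b).+1)%N.
          by rewrite ltnS leq_mul2l L_size orbT.
        by rewrite leq_exp2r// muln_gt0 (leq_trans _ k16).
      by rewrite leq_mul2r L_size orbT.
    rewrite -(ler_nat R) !natrM !natrX in sZb.
    have -> : (512 * t) ^+ N = 2 ^+ (11 * N) / 2 ^+ (k * N).
      rewrite !exprM -expr_div_n tE; congr (_ ^+ N).
      by rewrite exprVn mulrA; congr (_ / _); ring.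
    rewrite mulrA ler_pdivrMr ?exprn_gt0// -ler_pdivrMl; last first.
      by apply: exprn_gt0; rewrite invr_gt0 ltr0n.
    by rewrite exprVn invrK mulrC.
  move=> z _; have [zr|zr] := leP (rho / 2) (norm2 z); last first.
    by apply: (small_le _ _ (small0 P p0)) => // w [].
  have rhop : 0 < rho by rewrite /rho !mulr_gt0// exprn_gt0.
  have z0 : z != 0.
    by apply/eqP => zz; move: zr; rewrite zz norm2_0; lra.
  apply: (small_le _ (lexx _) (small_small_ball iid iso lc sym z0 tp t1 N0)).
  move=> w [_] /le_trans; apply; rewrite -/sq.
  have -> : t ^+ 2 * sq * norm2 z = (t ^+ 2 * norm2 z) * sq by ring.
  apply: ler_wpM2r; first exact: ltW.
  apply: (@le_trans _ _ (t ^+ 2 * (rho / 2))); last by rewrite ler_wpM2l// sqr_ge0.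
  rewrite tE /v /rho exprMn.
  have e2 : (2^-1 ^+ k) ^+ 2 * 16 ^+ k = 4 ^+ k :> R.
    by rewrite -exprM mulnC exprM -exprMn; congr (_ ^+ k); field.
  have -> : 4 ^+ 2 * (2^-1 ^+ k) ^+ 2 * (16 ^+ k * (16 * r) / 2) =
     4 ^+ 2 * ((2^-1 ^+ k) ^+ 2 * 16 ^+ k) * (16 * r) / 2 by ring.
  rewrite e2; set q := 4 ^+ k; lra.
have -> : 4 * 256^-1 ^+ k = 2 * 256^-1 ^+ k + 256^-1 ^+ k + 256^-1 ^+ k :> R by ring.
apply: (small_le _ (lexx _) (smallU (smallU
  (small_bad_chaining k iid iso L_size Ns2) smallA) smallZ)).
move=> w /= [x [Kx xn /kerGE xker]].
have [|gc] := pselect (bad_chaining mu X L s0 v w); first by move=> ?; left; left.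
have [|gA] := pselect (BA w); first by move=> ?; left; right.
right; have [|z [u [al [be [zZ [Ku ur] /andP[al0 al80] hbe zE]]]]] := hZ x Kx.
  by rewrite xn.
have [pA pr pd] := piA u Ku ur.
have uT : (K `&` sphere r) u by [].
have [_ hs hsum] := piP uT.
have v0 : 0 < v by lra.
have chain := @chaining_bound _ _ N _ _ mu X L s0 G pi C v w u iso v0 G0 gc
  (fun s => conj (let: And3 h _ _ := hs s in h) (let: And3 _ _ h := hs s in h)) hsum.
have gamA : norm2 (Gam X w (pi s0 u)) <= m%:R * sq * r.
  by rewrite leNgt; apply/negP => h; apply: gA; exists (pi s0 u).
have chain' : norm2 (Gam X w (u - pi s0 u)) <= v * r * sq / 80.
  apply: (le_trans chain); rewrite /G -/sq.
  have : 0 <= v * r * sq by rewrite !mulr_ge0// ltW.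
  have -> : 25 * v * (sq * (r / 2048)) = 25 / 2048 * (v * r * sq) by ring.
  by lra.
have mi : 0 < (m%:R : R)^-1 by rewrite invr_gt0 ltr0n.
(* The distance from [x] to [z] is at most [2 * (80 / 32 + 1) * r = 7 * r], far below [rho / 2]. *)
exists z => //; split.
  rewrite -xn in x0n *.
  have : norm2 (x - z) <= 7 * r.
    rewrite zE norm2Z ger0_norm//.
    have h1 := norm2D (al *: (u - pi s0 u)) (be *: pi s0 u).
    rewrite !norm2Z pr (ger0_norm al0) in h1.
    have h2 : al * norm2 (u - pi s0 u) <= 80 * (r / 32).
      by apply: ler_pM => //; exact: norm2_ge0.
    have h3 : `|be| * r <= r.
      rewrite -[leRHS]mul1r ler_wpM2r ?(ltW rp)// (le_trans hbe)// invf_le1// ltr0n//.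
    lra.
  have := norm2_le_dist x z; rewrite xn /rho; nra.
(* Here the kernel enters: the image of [x] vanishes, so that of [z] consists of approximation
   errors only. *)
have e : Gam X w z = - (2 *: (al *: Gam X w (u - pi s0 u) + be *: Gam X w (pi s0 u))).
  rewrite /Gam -!samplingZ -samplingD -samplingZ -zE samplingB -/(Gam X w x) xker.
  by rewrite sub0r opprK.
rewrite e norm2N norm2Z ger0_norm//.
have h1 := norm2D (al *: Gam X w (u - pi s0 u)) (be *: Gam X w (pi s0 u)).
rewrite !norm2Z (ger0_norm al0) in h1.
have h2 : al * norm2 (Gam X w (u - pi s0 u)) <= 80 * (v * r * sq / 80).
  by apply: ler_pM => //; exact: norm2_ge0.
have h3 : `|be| * norm2 (Gam X w (pi s0 u)) <= m%:R^-1 * (m%:R * sq * r).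
  by apply: ler_pM => //; exact: norm2_ge0.
have h4 : m%:R^-1 * (m%:R * sq * r) = sq * r.
  by rewrite -!mulrA mulKf// pnatr_eq0 -lt0n.
have h5 : sq * r <= v * r * sq.
  by rewrite -mulrA mulrC ler_peMl// mulr_ge0// ltW.
lra.
Qed.

End kernel.

(** * Expectation of the diameter *)

(** Measurability of the diameter is not established. The integral of a nonnegative function is a
    supremum over simple functions below it, so it is monotone for arbitrary functions. *)
Lemma ge0_le_integral_lower {R : realType} {d} {T : measurableType d}
    (P : {measure set T -> \bar R}) (f g : T -> \bar R) :
  (forall x, 0 <= f x)%E -> (forall x, f x <= g x)%E ->
  (\int[P]_x f x <= \int[P]_x g x)%E.
Proof.
move=> f0 fg; rewrite !ge0_integralTE//; last by move=> x; exact: le_trans (fg x).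
by apply: ereal_sup_le => _ [h hf <-]; exists h => // x; exact: le_trans (fg x).
Qed.

Lemma measurable_nneseries_indic {R : realType} {d} {T : measurableType d}
    (B : nat -> set T) (c : nat -> R) : (forall i, measurable (B i)) ->
  (forall i, 0 <= c i) ->
  measurable_fun setT (fun w => \sum_(i <oo) (c i * \1_(B i) w)%:E)%E.
Proof.
move=> mB c0; apply: ge0_emeasurable_sum => i.
- by move=> w _ _; rewrite lee_fin mulr_ge0.
- by move=> _; apply/measurable_EFinP; apply: measurable_funM => //; exact: measurable_indic.
Qed.

(** The left side, times [r], is the outer radius of shell [16 + i] times the probability bound at
    its inner radius. *)
Lemma shell_weight_le {R : realFieldType} i :
  64 * (16 ^+ 17 * 256^-1 ^+ 16) * (16 ^+ i * 256^-1 ^+ i) <= 2^-1 ^+ i :> R.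
Proof.
have e1 : (16 : R) ^+ i * 256^-1 ^+ i = 16^-1 ^+ i.
  by rewrite -exprMn; congr (_ ^+ i); field.
have e2 : (16 : R) ^+ 17 * 256^-1 ^+ 16 = 16 * 16^-1 ^+ 16.
  by rewrite exprS -mulrA -exprMn; congr (_ * _ ^+ 16); field.
have h1 : 16^-1 ^+ i <= 2^-1 ^+ i :> R.
  by apply: lerXn2r; rewrite ?nnegrE; lra.
have h2 : 64 * (16 * 16^-1 ^+ 16) <= 1 :> R.
  have : 16^-1 ^+ 16 <= 16^-1 ^+ 3 :> R by apply: ler_wiXn2l; [lra|lra|].
  by set q := _ ^+ 16; lra.
have h3 : 0 <= 16^-1 ^+ i :> R by apply: exprn_ge0; lra.
by rewrite e1 e2; apply: le_trans h1; rewrite -[leRHS]mul1r; apply: ler_wpM2r.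
Qed.

Section diameter.
Context {R : realType} {n N : nat} {d : measure_display} {T : measurableType d}.
Context (P : probability T R) (X : 'I_N -> T -> Rn R n).
Context (K : set 'rV[R]_n).
Hypothesis K_convex : forall x y (t : R), K x -> K y -> 0 <= t -> t <= 1 ->
  K (t *: x + (1 - t) *: y).
Hypothesis K_sym : forall x, K x -> K (- x).
Hypothesis K_ne : K !=set0.
Context (r : R) (r0 : 0 < r).

Lemma kerG_scale w x (a : R) : kerG X w x -> kerG X w (a *: x).
Proof. by move=> h i; rewrite dotZr h mulr0. Qed.

Lemma diam_ge0 w : (0 <= diam (K `&` kerG X w))%E.
Proof.
have K0 : K 0.
  have [x Kx] := K_ne; rewrite -(scale0r x); apply: convex_shrink => //.
  by rewrite lexx ler01.
apply: ereal_sup_ubound; exists 0; last exists 0.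
- by split => // i; rewrite -(scale0r (0 : 'rV[R]_n)) dotZr mul0r.
- by split => // i; rewrite -(scale0r (0 : 'rV[R]_n)) dotZr mul0r.
- by rewrite subr0 norm2_0.
Qed.

Lemma diam_le w (h : \bar R) :
  (forall x, K x -> kerG X w x -> (norm2 x)%:E <= h)%E ->
  (diam (K `&` kerG X w) <= 2%:E * h)%E.
Proof.
move=> hx; apply: ge_ereal_sup => _ [x [Kx kx] [y [Ky ky] ->]].
rewrite (@le_trans _ _ ((norm2 x)%:E + (norm2 y)%:E)%E)//.
  by rewrite -EFinD lee_fin norm2B.
have h0 : (0 <= h)%E by rewrite (le_trans _ (hx x Kx kx))// lee_fin norm2_ge0.
by rewrite -[2]/(1 + 1) EFinD ge0_muleDl ?lee_fin// mul1e leeD// hx.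
Qed.

(** A kernel vector of [K] longer than a given radius can be shrunk, within [K] and the kernel, to
    exactly that radius. Hence every norm in the section is at most [rho 16] plus the outer radii of
    the shells whose exceptional set [B i] occurs. *)
Lemma integral_diam_le :
  (forall k, (16 <= k)%N ->
    small P [set w | exists x, [/\ K x, norm2 x = 16 ^+ k * (16 * r) & kerG X w x]]
      (4 * 256^-1 ^+ k)) ->
  (\int[P]_w diam (K `&` kerG X w) <= (2 ^+ 70 * r)%:E)%E.
Proof.
move=> hsmall.
have /choice[B hB] : forall i, exists B : set T, [/\ measurable B,
    [set w | exists x, [/\ K x, norm2 x = 16 ^+ (16 + i) * (16 * r) & kerG X w x]] `<=` B &
    (P B <= (4 * 256^-1 ^+ (16 + i))%:E)%E].
  by move=> i; apply: hsmall; exact: leq_addr.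
pose rho k : R := 16 ^+ k * (16 * r).
have rho0 k : 0 <= rho k.
  by apply: mulr_ge0; [apply: exprn_ge0; exact: ler0n|apply: mulr_ge0; [exact: ler0n|exact: ltW]].
pose c i := rho (16 + i).+1.
have c0 i : 0 <= c i by exact: rho0.
have mB i : measurable (B i) by case: (hB i).
have t0 i w : (0 <= (c i * \1_(B i) w)%:E)%E by rewrite lee_fin mulr_ge0 ?indicE.
pose S w : \bar R := (\sum_(i <oo) (c i * \1_(B i) w)%:E)%E.
have S0 w : (0 <= S w)%E by apply: nneseries_ge0 => i _ _; exact: t0.
pose H w := ((rho 16)%:E + S w)%E.
have xH w x : K x -> kerG X w x -> ((norm2 x)%:E <= H w)%E.
  move=> Kx kx.
  have [x16|x16] := leP (norm2 x) (rho 16%N).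
    by rewrite -[leLHS]adde0 leeD// lee_fin.
  have ex : exists k, norm2 x <= rho (16 + k)%N.
    have q0 : 0 <= norm2 x / (16 * r).
      by rewrite divr_ge0 ?norm2_ge0// mulr_ge0// ltW.
    have /andP[_ /ltW h] := truncn_itv q0; exists (Num.truncn (norm2 x / (16 * r))).+1.
    rewrite /rho -ler_pdivrMr ?mulr_gt0// (le_trans h)// -natrX ler_nat.
    (* A power of 16 exceeds its exponent, so some radius bounds [norm2 x]; the least such radius
       locates the shell. *)
    by rewrite ltnW// (@leq_ltn_trans (16 + (Num.truncn (norm2 x / (16 * r))).+1))// ?leq_addl// ltn_expl.
  pose j := ex_minn ex; have := ex_minnP ex; rewrite -/j.
  case: (ex_minnP ex) @j => j' hj' minj j _; rewrite /j {j}.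
  case: j' hj' minj => [|i] hi minj; first by move: x16; rewrite ltNge -[16%N]addn0 hi.
  have ilt : rho (16 + i)%N < norm2 x by rewrite ltNge; apply/negP => /minj; rewrite ltnn.
  have xp : 0 < norm2 x by rewrite (le_lt_trans _ ilt).
  have wB : B i w.
    case: (hB i) => _ + _; apply.
    have [Kt tr] := convex_rescale K_convex K_sym Kx (rho0 _) (ltW ilt) xp.
    by exists ((rho (16 + i)%N / norm2 x) *: x); split => //; exact: kerG_scale.
  apply: (@le_trans _ _ (S w)); last by rewrite leeDr ?lee_fin.
  apply: (@le_trans _ _ (\sum_(0 <= l < i.+1) (c l * \1_(B l) w)%:E)%E); last first.
    by apply: nneseries_lim_ge => l _ _; exact: t0.
  rewrite big_nat_recr//= (@le_trans _ _ (c i * \1_(B i) w)%:E)//; last first.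
    by rewrite leeDr// sume_ge0.
  by rewrite lee_fin indicE mem_set// mulr1 /c -addnS.
apply: (@le_trans _ _ (\int[P]_w (2%:E * H w))%E).
  by apply: ge0_le_integral_lower => w; [exact: diam_ge0|apply: diam_le => x; exact: xH].
have mS : measurable_fun setT S by exact: measurable_nneseries_indic.
have r16 : (0 <= (rho 16)%:E)%E by rewrite lee_fin.
rewrite ge0_integralZl_EFin//; last 2 first.
- by move=> w _; rewrite adde_ge0.
- exact: emeasurable_funD.
rewrite ge0_integralD// integral_cst// [X in ((rho 16%N)%:E * X)%E]probability_setT mule1.
have IS : (\int[P]_w S w <= (2 * r)%:E)%E.
  rewrite integral_nneseries//; last first.
    by move=> i; apply/measurable_EFinP; apply: measurable_funM => //; exact: measurable_indic.
  apply: lime_le; first by apply: is_cvg_nneseries => i _ _; exact: integral_ge0.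
  apply: nearW => m; rewrite big_mkord.
  apply: (@le_trans _ _ (\sum_(i < m) (r * 2^-1 ^+ i)%:E)%E); last first.
    rewrite sumEFin lee_fin -mulr_sumr mulrC; apply: ler_wpM2r; first exact: ltW.
    exact: sum_geometric_half.
  apply: lee_sum => i _.
  under eq_integral do rewrite EFinM.
  rewrite ge0_integralZl_EFin//; last first.
    by apply/measurable_EFinP; exact: measurable_indic.
  rewrite integral_indic// setIT.
  case: (hB i) => _ _ hP; apply: (le_trans (lee_pmul _ _ (lexx _) hP)) => //.
    by rewrite lee_fin.
  rewrite -EFinM lee_fin /c /rho -addSn exprD [256^-1 ^+ _]exprD.
  have -> : 16 ^+ 17 * 16 ^+ i * (16 * r) * (4 * (256^-1 ^+ 16 * 256^-1 ^+ i)) =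
      r * (64 * (16 ^+ 17 * 256^-1 ^+ 16) * (16 ^+ i * 256^-1 ^+ i)) by ring.
  by apply: ler_wpM2l; [exact: ltW|exact: shell_weight_le].
apply: (@le_trans _ _ (2%:E * ((rho 16)%:E + (2 * r)%:E))%E).
  by rewrite lee_pmul2l// ?lte_fin// leeD.
(* The total is [2 * (16 * 2 ^ 64 + 2) * r], within [64 * 2 ^ 64 * r]. *)
rewrite -EFinD -EFinM lee_fin /rho.
have -> : 16 ^+ 16 = 2 ^+ 64 :> R by rewrite (exprM 2 4 16); congr (_ ^+ 16); ring.
have -> : 2 ^+ 70 = 64 * 2 ^+ 64 :> R by rewrite (exprD 2 6 64); congr (_ * _); ring.
have : 1 <= 2 ^+ 64 :> R by rewrite exprn_ege1// ler1n.
set q := 2 ^+ 64 => q1; have rp : 0 < r := r0; nra.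
Qed.

End diameter.

(* [2 ^+ 70 : rat] is a unary number: stated for a variable [m], no conversion
   can unfold it. *)
Lemma rat_pow2 m : exists c : rat, 0 < c /\
  (forall R : realType, ratr c = 2 ^+ m :> R) /\
  (forall R : realType, ratr c^-1 = (2 ^+ m)^-1 :> R).
Proof.
exists (2 ^+ m); split; first by rewrite exprn_gt0.
by split=> R; rewrite ?fmorphV rmorphXn /= ratr_nat.
Qed.

Theorem theorem6p3 :
  exists c c1 : rat, 0 < c /\ 0 < c1 /\
  forall (R : realType) (n N : nat) (mu : probability (Rn R n) R)
    (d : measure_display) (T : measurableType d) (P : probability T R)
    (X : 'I_N -> T -> Rn R n),
    (0 < N)%N -> isotropic mu -> log_concave mu -> symmetric_measure mu ->
    iid_law P mu X ->
    forall K : set 'rV[R]_n, convex_body K ->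
    (\int[P]_w diam (K `&` kerG X w) <=
      (ratr c1)%:E * ereal_inf [set r%:E | r in [set r : R | (0 < r)%R /\
         (gamma2 (K `&` sphere r) (psi2dist mu) *
            ((Num.sqrt (N%:R : R))^-1)%R%:E <= (ratr c * r)%R%:E)%E]])%E.
Proof.
(* [2 ^ 12] is twice 2048, which turns the weak inequality defining the infimum into the strict one
   of [gamma2_nets]. *)
have [c [c_gt0 [_ cE]]] := rat_pow2 12; have [c1 [c1_gt0 [c1E _]]] := rat_pow2 70.
exists c^-1, c1; split; [by rewrite invr_gt0|split=> //].
move=> R n N mu d T P X N0 iso lc sym iid K [_ Kc Ks Ki].
rewrite c1E cE.
have Kne : K !=set0 by have [x /interior_subset Kx] := Ki; exists x.
have c1p : 0 < (2 : R) ^+ 70 by rewrite exprn_gt0.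
rewrite -ereal_inf_pZl//; apply/ereal_infP => _ [_ [r [rp hr] <-] <-]; rewrite -EFinM.
have sqp : 0 < Num.sqrt (N%:R : R) by rewrite sqrtr_gt0 ltr0n.
(* If [K] misses the sphere, then by shrinking it lies in the ball of radius [r], and its diameter
   is at most [2 * r] for every sample. *)
have [Tne|Te] := pselect ((K `&` sphere r) !=set0); last first.
  have small_norm x : K x -> norm2 x <= r.
    move=> Kx; rewrite leNgt; apply/negP => xr; apply: Te.
    have [h1 h2] := convex_rescale Kc Ks Kx (ltW rp) (ltW xr) (lt_trans rp xr).
    by exists ((r / norm2 x) *: x).
  apply: (@le_trans _ _ (\int[P]_w cst (2 * r)%:E w)%E).
    apply: ge0_le_integral_lower => w; first exact: diam_ge0.
    rewrite /cst EFinM; apply: diam_le => x Kx _; rewrite lee_fin; exact: small_norm.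
  rewrite integral_cst// [X in (_ * X)%E]probability_setT mule1 lee_fin.
  rewrite ler_wpM2r ?(ltW rp)// -[leLHS]expr1 ler_weXn2l// ler1n//.
have hG : (gamma2 (K `&` sphere r) (psi2dist mu) <
    (Num.sqrt N%:R * (r / 2048))%:E)%E.
  have : (gamma2 (K `&` sphere r) (psi2dist mu) <=
      ((2 ^+ 12)^-1 * r * Num.sqrt N%:R)%:E)%E.
    by rewrite EFinM -lee_pdivrMr.
  move=> /le_lt_trans; apply; rewrite lte_fin mulrC ltr_pM2l// mulrC.
  by rewrite ltr_pM2l//; lra.
have [L [pi [C [t0 [sL hpi]]]]] := gamma2_nets hG.
apply: (integral_diam_le Kc Ks Kne rp) => k k16.
have N1000 := sample_size_large iso Ks hpi rp Tne.
exact: (kernel_radius_small iid iso lc sym Kc Ks sL hpi rp N1000 k16).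
Qed.
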